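(* Let $n \ge 1$ be an integer, $p$ a prime, and $GF(p^n)$ the field with $p^n$ elements. Let $$a(n) = \begin{cases} d(n)^2 - d(n) + \sigma(n)-1; & \text{if } p =2 \text{ and } n \text{ is even}, \\ d(n)^2 - d(n) + \sigma(n); & \text{if } p >2 \text{ or } n \text{ is odd}, \end{cases}$$ $$b(n) = \sum_{d \mid n} \frac{p^n-1}{p^d-1}, \quad \text{and} \quad c(n) = d(2n)-d(n).$$ Then the unital compressed commuting graph of the ring $\mathcal{M}_2(GF(p^n))$ is $$\Lambda^1(\mathcal{M}_2(GF(p^n))) \cong K_{d(n)}^\circ \vee \left(\tfrac{p^{2n} + p^n}{2}K_{a(n)}^\circ \cup (p^n + 1)K_{b(n)}^\circ \cup \tfrac{p^{2n} - p^n}{2}K_{c(n)}^\circ\right).$$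
   Context: $\mathcal{M}_2(\mathbb{F})$ is the ring of $2\times 2$ matrices over the field $\mathbb{F}$. $d(n)$ is the number of positive divisors of $n$ and $\sigma(n)=\sum_{d\mid n} d$ is the sum of the positive divisors of $n$. $K_m^\circ$ is the complete graph on $m$ vertices with a loop at every vertex. For graphs $G,H$: $G\cup H$ is their disjoint union, $tG$ is the disjoint union of $t$ copies of $G$, and $G\vee H$ is their join (the disjoint union together with all edges between vertices of $G$ and vertices of $H$). For a unital ring $R$ and $a\in R$, $\langle a\rangle_1=\{q(a)\mid q\in\mathbb{Z}[x]\}$ is the unital subring generated by $a$. The unital compressed commuting graph $\Lambda^1(R)$ is the undirected graph with vertex set $\{\langle a\rangle_1 \mid a\in R\}$, in which $\langle a\rangle_1$ and $\langle b\rangle_1$ are joined by an edge (a loop if they are equal) iff $ab=ba$. *)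

(* Defs.v *)
From HB Require Import structures.
From mathcomp Require Import all_boot all_order all_algebra.
From mathcomp Require Import boolp classical_sets.
Set Implicit Arguments.
Unset Strict Implicit.
Unset Printing Implicit Defensive.
Import GRing.Theory.

Local Open Scope ring_scope.

(* Undirected graphs without multiple edges; loops are allowed. *)
Record graph : Type := Graph {
  vertex : Type;
  adj : vertex -> vertex -> Prop;
  adj_sym : forall x y, adj x y -> adj y x
}.

Definition graph_iso (G H : graph) : Prop :=
  exists f : vertex G -> vertex H,
    bijective f /\ forall x y, adj x y <-> adj (f x) (f y).

Definition looped_complete (m : nat) : graph :=
  @Graph 'I_m (fun _ _ => True) (fun _ _ _ => I).

Definition union_adj (G H : graph) (x y : vertex G + vertex H) : Prop :=
  match x, y with
  | inl u, inl v => adj u v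
  | inr u, inr v => adj u v
  | _, _ => False
  end.

Lemma union_adj_sym (G H : graph) (x y : vertex G + vertex H) :
  union_adj x y -> union_adj y x.
Proof. by case: x y => [u|u] [v|v] //=; exact: adj_sym. Qed.

Definition graph_union (G H : graph) : graph := Graph (@union_adj_sym G H).

Definition copies_adj (t : nat) (G : graph) (x y : 'I_t * vertex G) : Prop :=
  x.1 = y.1 /\ adj x.2 y.2.

Lemma copies_adj_sym (t : nat) (G : graph) (x y : 'I_t * vertex G) :
  copies_adj x y -> copies_adj y x.
Proof. by case=> e h; split; [rewrite e | exact: adj_sym]. Qed.

Definition graph_copies (t : nat) (G : graph) : graph :=
  Graph (@copies_adj_sym t G).

Definition join_adj (G H : graph) (x y : vertex G + vertex H) : Prop :=
  match x, y with
  | inl u, inl v => adj u v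
  | inr u, inr v => adj u v
  | _, _ => True
  end.

Lemma join_adj_sym (G H : graph) (x y : vertex G + vertex H) :
  join_adj x y -> join_adj y x.
Proof. by case: x y => [u|u] [v|v] //=; exact: adj_sym. Qed.

Definition graph_join (G H : graph) : graph := Graph (@join_adj_sym G H).

Definition unital_subring_gen (R : nzRingType) (a : R) : set R :=
  [set x | exists q : {poly int}, x = (map_poly intr q).[a]]%classic.

Definition subring_vertex (R : nzRingType) : Type :=
  {A : set R | exists a : R, A = unital_subring_gen a}.

(* Independent of the choice of the generators: see [commuting_adjE]. *)
Definition commuting_adj (R : nzRingType) (A B : subring_vertex R) : Prop :=
  exists a b : R, [/\ sval A = unital_subring_gen a,
                      sval B = unital_subring_gen b & a * b = b * a].

Lemma commuting_adj_sym (R : nzRingType) (A B : subring_vertex R) :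
  commuting_adj A B -> commuting_adj B A.
Proof. by case=> a [b [hA hB hab]]; exists b, a; split. Qed.

Definition compressed_commuting_graph (R : nzRingType) : graph :=
  Graph (@commuting_adj_sym R).

Lemma mem_unital_subring_gen (R : nzRingType) (a : R) :
  unital_subring_gen a a.
Proof. by exists 'X; rewrite map_polyX hornerX. Qed.

Lemma comm_horner_int (R : nzRingType) (q : {poly int}) (a b : R) :
  GRing.comm b a -> GRing.comm b (map_poly intr q).[a].
Proof.
move=> hba; rewrite horner_poly.
apply: commr_sum => i _; apply: commrM; last exact: commrX.
exact: commr_int.
Qed.

Lemma commuting_adjE (R : nzRingType) (A B : subring_vertex R) (a b : R) :
  sval A = unital_subring_gen a -> sval B = unital_subring_gen b ->
  commuting_adj A B <-> a * b = b * a.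
Proof.
move=> hA hB; split=> [[a' [b' [hA' hB' hab]]]|hab]; last by exists a, b; split.
have : unital_subring_gen a' a.
  by rewrite -hA' hA; exact: mem_unital_subring_gen.
have : unital_subring_gen b' b.
  by rewrite -hB' hB; exact: mem_unital_subring_gen.
move=> [q ->] [r ->].
by apply: comm_horner_int; apply/commr_sym/comm_horner_int/commr_sym.
Qed.

Local Open Scope nat_scope.

Definition num_divisors (n : nat) : nat := size (divisors n).

Definition sum_divisors (n : nat) : nat := \sum_(d <- divisors n) d.

(* For n > 0 and p prime, truncated subtraction agrees with integer
   subtraction in the next three definitions, and every quotient in
   [nilpotent_count] is exact. *)
Definition split_count (p n : nat) : nat :=
  if (p == 2) && ~~ odd n
  then num_divisors n ^ 2 - num_divisors n + sum_divisors n - 1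
  else num_divisors n ^ 2 - num_divisors n + sum_divisors n.

Definition nilpotent_count (p n : nat) : nat :=
  \sum_(d <- divisors n) (p ^ n - 1) %/ (p ^ d - 1).

Definition nonsplit_count (n : nat) : nat :=
  num_divisors (2 * n) - num_divisors n.

(* Main.v *)
(* In characteristic p the ring <a>_1 is F_p[a].  A non-scalar 2x2 matrix a has
   commutant F[a], a two-dimensional algebra, and two non-scalar matrices commute
   iff their commutants coincide.  So the graph consists of the scalar vertices,
   adjacent to everything, and of one complete block per commutant.

   Commutants are counted through what they contain: 2 nontrivial idempotents if
   F[a] = F x F, q - 1 nonzero nilpotents if F[a] = F[e]/(e^2), and neither if
   F[a] is the field with q^2 elements.

   Within a block, subrings are classified by Frobenius degrees.  In a field they
   are the subfields.  In F x F, F_p[(a, b)] is a product of two subfields when a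
   and b are not conjugate over F_p, and the graph of a power of Frobenius
   otherwise.  In F[e]/(e^2), (a + b e)^q = a, so F_p[a + b e] = K + K b e with
   K = F_p(a). *)
From HB Require Import structures.
Require Import Defs.
From mathcomp Require Import all_boot all_order all_algebra.
From mathcomp Require Import all_fingroup all_solvable all_field.
From mathcomp Require Import boolp.
From mathcomp Require Import ring zify.
Set Implicit Arguments.
Unset Strict Implicit.
Unset Printing Implicit Defensive.
Import GRing.Theory.
Local Open Scope ring_scope.

(** * Generated subrings *)

(** The correction for p = 2 and n even comes from the field with 4 elements: its two elements of
    degree 2 are conjugate, so F_4 x F_4 has no single generator. Every other product of two
    subfields has one: elements of distinct degrees are never conjugate, a primitive element and its
    inverse serve for equal degrees above 1, and 0 and 1 serve in degree 1. So a block of type F x F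
    has d(n)^2 products, up to this correction, and sigma(n) - d(n) graphs, since the identity power
    of Frobenius yields only scalars.

    Generated subrings are bounded below by counting integer polynomials with coefficients in 0,
    ..., p - 1: agreement at the generator spreads to all its conjugates, which leaves too many
    roots.

    Field commutants are not counted directly. They are what remains of the (q^4 - q) / (q^2 - q) =
    q^2 + q + 1 commutants after the other two types are removed. *)

Definition gen (R : finNzRingType) (a : R) : {set R} :=
  [set x | `[< unital_subring_gen a x >]].

Section Gen.
Variable R : finNzRingType.
Implicit Types a x y : R.

Lemma genP a x :
  reflect (exists q : {poly int}, x = (map_poly intr q).[a]) (x \in gen a).
Proof. by rewrite inE; apply: asboolP. Qed.

Lemma gen_self a : a \in gen a.
Proof. by rewrite inE; apply/asboolP; apply: mem_unital_subring_gen. Qed.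

Lemma comm_poly_int (q : {poly int}) a : comm_poly (map_poly intr q) a.
Proof. exact: comm_horner_int. Qed.

Lemma gen_subring_closed a : subring_closed (gen a).
Proof.
split=> [|_ _ /genP[q ->] /genP[r ->]|_ _ /genP[q ->] /genP[r ->]].
- by apply/genP; exists 1; rewrite rmorph1 hornerC.
- by apply/genP; exists (q - r); rewrite rmorphB hornerD hornerN.
- apply/genP; exists (q * r); rewrite rmorphM hornerM_comm //.
  exact: comm_poly_int.
Qed.

Lemma gen_sub (S : {pred R}) a :
  subring_closed S -> a \in S -> {subset gen a <= S}.
Proof.
move=> [S1 SB SM] Sa _ /genP[q ->].
have S0 : 0 \in S by rewrite -(subrr 1) SB.
have SN x : x \in S -> - x \in S by move=> Sx; rewrite -sub0r SB.
have SD x y : x \in S -> y \in S -> x + y \in S.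
  by move=> Sx Sy; rewrite -(opprK y) SB ?SN.
have Sint (z : int) : z%:~R \in S.
  case: z => n; last rewrite NegzE rmorphN SN //=.
    by elim: n => [|n IH] //; rewrite intS rmorphD SD.
  by elim: n.+1 => [|m IH] //; rewrite intS rmorphD SD.
elim/poly_ind: q => [|q c IH]; first by rewrite rmorph0 horner0.
rewrite rmorphD rmorphM /= map_polyX map_polyC hornerD hornerMX hornerC.
by rewrite SD ?SM //; apply: Sint.
Qed.

End Gen.

Lemma horner_int_morph (R S : nzRingType) (f : {rmorphism R -> S})
    (q : {poly int}) (a : R) :
  (map_poly intr q).[f a] = f (map_poly intr q).[a].
Proof.
rewrite -horner_map -map_poly_comp; congr (_.[_]).
by apply: eq_map_poly => z /=; rewrite rmorph_int.
Qed.

(** The morphism laws are hypotheses because the lemma is applied to ad hoc coordinate maps that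
    carry no bundled structure. *)
Lemma gen_morph (R S : finNzRingType) (f : R -> S) (a : R) :
  zmod_morphism f -> monoid_morphism f -> gen (f a) = f @: gen a.
Proof.
move=> fB fM; pose g : {rmorphism R -> S} := HB.pack f
  (GRing.isZmodMorphism.Build R S f fB) (GRing.isMonoidMorphism.Build R S f fM).
apply/setP=> x; apply/genP/imsetP=> [[q ->]|[_ /genP[q ->] ->]].
  by exists (map_poly intr q).[a]; [apply/genP; exists q | apply: (horner_int_morph g)].
by exists q; rewrite (horner_int_morph g).
Qed.

(** Double counting by fibers. It converts counts of idempotents, nilpotents or nonzero vectors into
    counts of commutants or lines. *)
Lemma card_uniform_imset (T U : finType) (f : T -> U) (D : {set T}) s :
  {in D, forall x, #|[set y in D | f y == f x]| = s} ->
  (#|f @: D| * s)%N = #|D|.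
Proof.
move=> fib; rewrite -sum_nat_const -[RHS]sum1_card.
rewrite [RHS](partition_big f [in f @: D]) => [|x xD]; last exact: imset_f.
apply: eq_bigr => _ /imsetP[x xD ->].
by rewrite -(fib x xD) -sum1_card; apply: eq_bigl => y; rewrite inE.
Qed.

(** Each family of subrings is counted through a duplicate-free list of codes built from
    divisors. *)
Lemma card_imset_seq (C : eqType) (T : finType) (s : seq C) (g : C -> T)
    (X : {set T}) :
  uniq s -> {in s &, injective g} -> (forall x, (x \in X) = (x \in map g s)) ->
  #|X| = size s.
Proof.
move=> us gi XE; rewrite -(size_map g) -(card_uniqP _).
  by apply: eq_card => x; rewrite XE.
by rewrite map_inj_in_uniq.
Qed.

(** * Subfields and Frobenius degree *)

Definition frob (p : nat) (R : nzRingType) (x : R) : R := x ^+ p.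
(* The degree of x over the prime field. *)
Definition fdeg (p : nat) (E : finFieldType) (x : E) : nat := fingraph.order (@frob p E) x.
(* The subfield with p ^ d elements, provided that d divides the degree of E over
   the prime field. *)
Definition fixd (p : nat) (E : finFieldType) (d : nat) : {set E} :=
  [set x | x ^+ (p ^ d) == x].

Section FiniteField.
Variables (p N : nat) (E : finFieldType).
Hypotheses (pp : prime p) (cardE : #|E| = (p ^ N)%N).
Implicit Types x y a b : E.
Local Notation fr := (@frob p E).
Local Notation deg := (@fdeg p E).
Local Notation K := (@fixd p E).

Lemma pcharE : p \in [pchar E].
Proof. exact: card_finPcharP cardE pp. Qed.
Let chE := pcharE.

Lemma frobE x : fr x = pFrobenius_aut chE x.
Proof. by []. Qed.

Lemma frob_inj : injective fr.
Proof. by move=> x y; rewrite !frobE; apply: fmorph_inj. Qed.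

Lemma iter_frob k x : iter k fr x = x ^+ (p ^ k).
Proof. by elim: k => //= k ->; rewrite /frob -exprM expnSr. Qed.

Lemma exprBp k x y : (x - y) ^+ (p ^ k) = x ^+ (p ^ k) - y ^+ (p ^ k).
Proof.
by rewrite -!iter_frob; elim: k => //= k ->; rewrite !frobE rmorphB.
Qed.

Lemma fixdP d x : reflect (x ^+ (p ^ d) = x) (x \in K d).
Proof. by rewrite inE; apply: eqP. Qed.

Lemma fixd_subring_closed d : subring_closed (K d).
Proof.
split=> [|x y /fixdP ex /fixdP ey|x y /fixdP ex /fixdP ey]; apply/fixdP.
- exact: expr1n.
- by rewrite exprBp ex ey.
- by rewrite exprMn ex ey.
Qed.

Lemma fdeg_gt0 x : (0 < deg x)%N.
Proof. exact: fingraph.order_gt0. Qed.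

Lemma fdeg_fix x : x \in K (deg x).
Proof. by apply/fixdP; rewrite -iter_frob iter_order //; apply: frob_inj. Qed.

Lemma fix_dvd k x : (x \in K k) = (deg x %| k)%N.
Proof.
have xm m : x ^+ (p ^ (m * deg x)) = x.
  elim: m => [|m IH]; first by rewrite mul0n expr1.
  by rewrite mulSn expnD exprM (fixdP _ _ (fdeg_fix x)).
apply/fixdP/idP=> [|/dvdnP[m ->] //].
(* Only [k] modulo [deg x] matters, and the first [deg x] iterates are distinct, so the remainder is
   0. *)
rewrite {1}(divn_eq k (deg x)) expnD exprM xm.
have lt := ltn_pmod k (fdeg_gt0 x).
rewrite -iter_frob -(nth_traject _ lt) => h.
have dl : deg x = size (fingraph.orbit fr x) by rewrite size_orbit.
rewrite /dvdn -(nth_uniq x _ _ (orbit_uniq fr x)) -?dl ?fdeg_gt0 //.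
by rewrite /fingraph.orbit -/(deg x) h nth_traject ?fdeg_gt0.
Qed.

Lemma fdeg_dvdN x : (deg x %| N)%N.
Proof. by rewrite -fix_dvd; apply/fixdP; rewrite -cardE expf_card. Qed.

Lemma card_fixd_le d : (0 < d)%N -> (#|K d| <= p ^ d)%N.
Proof.
move=> d0; have p1 : (1 < p ^ d)%N by rewrite -(expn0 p) ltn_exp2l // prime_gt1.
have sz : size ('X^(p ^ d) - 'X : {poly E}) = (p ^ d).+1.
  by rewrite size_polyDl ?size_polyXn // size_polyN size_polyX.
rewrite -ltnS -sz fintype.cardE; apply: max_poly_roots; rewrite ?enum_uniq //.
  by rewrite -size_poly_eq0 sz.
by apply/allP=> x; rewrite mem_enum => /fixdP ex; rewrite rootE !hornerE ex subrr.
Qed.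

(** Integer representatives of the polynomials over F_p of degree below [m]. The default 0 is never
    reached, since [i < m]. *)
Definition poly_code m (c : {ffun 'I_m -> 'I_p}) : {poly int} :=
  \poly_(i < m) (if insub i is Some j then (c j : nat)%:Z else 0).

(* Bounds the size of a generated subring from below by p ^ m, where m is the
   number of conjugates of the generator. *)
Lemma poly_code_inj m (rs : seq E) (c c' : {ffun 'I_m -> 'I_p}) :
  uniq rs -> size rs = m ->
  {in rs, forall x, (map_poly intr (poly_code c)).[x]
                  = (map_poly intr (poly_code c')).[x]} -> c = c'.
Proof.
move=> urs szrs ev; pose P : {poly E} := map_poly intr (poly_code c - poly_code c').
have szP : (size P <= m)%N.
  apply: leq_trans (size_poly _ _) _.
  apply: leq_trans (size_polyD _ _) _; rewrite size_polyN geq_max.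
  by rewrite !size_poly.
have P0 : P = 0.
  apply/eqP; apply: contraTT szP => Pn0; rewrite -ltnNge -szrs.
  apply: max_poly_roots => //; apply/allP=> x xrs.
  by rewrite rootE /P rmorphB /= hornerD hornerN ev // subrr.
apply/ffunP=> i; apply: val_inj.
have := congr1 (fun Q : {poly E} => Q`_i) P0; rewrite /P coef_map coefB !coef_poly.
rewrite ltn_ord valK coef0 /= rmorphB /= -!pmulrn => /eqP; rewrite subr_eq0 => /eqP h.
have := ltn_ord (c i); have := ltn_ord (c' i).
wlog le : c c' h {ev P szP P0} / (c i <= c' i)%N => [W|] l1 l2.
  by case: (leqP (c i) (c' i)) => [|/ltnW] le; [apply: W|symmetry; apply: W].
move/eqP: h; rewrite eq_sym -subr_eq0 -natrB // -(dvdn_pcharf chE) => dv.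
apply/eqP; rewrite eqn_leq le /= -subn_eq0; case: (posnP (c' i - c i)) => // /dvdn_leq.
by move/(_ _ dv); rewrite leqNgt (leq_ltn_trans (leq_subr _ _) l1).
Qed.

Lemma iter_horner_int k (q : {poly int}) a :
  (map_poly intr q).[a ^+ (p ^ k)] = (map_poly intr q).[a] ^+ (p ^ k) :> E.
Proof.
rewrite -!iter_frob; elim: k => //= k <-; set b := iter k _ _.
by rewrite !frobE horner_int_morph.
Qed.

(** Frobenius is a ring morphism, so it commutes with integer polynomials and carries an equality at
    [a] to each conjugate of [a]. *)
Lemma horner_orbit (P Q : {poly int}) a x :
  (map_poly intr P).[a] = (map_poly intr Q).[a] :> E ->
  x \in fingraph.orbit fr a -> (map_poly intr P).[x] = (map_poly intr Q).[x].
Proof.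
by move=> ev; rewrite -fconnect_orbit => /iter_findex <-; rewrite iter_frob !iter_horner_int ev.
Qed.

(** A squeeze: [gen a] lies in [K (deg a)], which has at most p^(deg a) elements as a set of roots,
    while the codes evaluated at [a] already give that many. *)
Lemma fgen_card_fixd a : gen a = K (deg a) /\ #|K (deg a)| = (p ^ deg a)%N.
Proof.
have sub : gen a \subset K (deg a).
  apply/subsetP; exact: gen_sub (fixd_subring_closed (deg a)) (fdeg_fix a).
have le1 : (p ^ deg a <= #|gen a|)%N.
  pose f (c : {ffun 'I_(deg a) -> 'I_p}) := (map_poly intr (poly_code c)).[a] : E.
  have fi : injective f.
    move=> c c' e; apply: (@poly_code_inj _ (fingraph.orbit fr a)) => //.
    - exact: orbit_uniq.
    - exact: size_orbit.
    - by move=> x; apply: horner_orbit.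
  rewrite -[X in (p ^ X)%N]card_ord -[X in (X ^ _)%N]card_ord -card_ffun -(card_image fi).
  by apply: subset_leq_card; apply/subsetP=> _ /imageP[c _ ->]; apply/genP; exists (poly_code c).
have le2 := subset_leq_card sub; have le3 := card_fixd_le (fdeg_gt0 a).
split; last by apply/eqP; rewrite eqn_leq le3 (leq_trans le1).
by apply/eqP; rewrite eqEcard sub (leq_trans le3).
Qed.

Lemma gen_fdeg a : gen a = K (deg a).
Proof. by case: (fgen_card_fixd a). Qed.

End FiniteField.

(** * Which degrees occur, and which pairs of degrees force conjugacy *)

Section FrobeniusDegree.
Variables (p N : nat) (E : finFieldType).
Hypotheses (pp : prime p) (N0 : (0 < N)%N) (cardE : #|E| = (p ^ N)%N).
Implicit Types x y a b : E.
Local Notation fr := (@frob p E).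
Local Notation deg := (@fdeg p E).
Local Notation K := (@fixd p E).
Local Notation D := (divisors N).

Lemma dvd_pred_exp m d : (d %| m)%N -> (p ^ d - 1 %| p ^ m - 1)%N.
Proof.
case/dvdnP=> k ->; rewrite mulnC expnM -[X in (_ %| _ - X)%N](exp1n k) subn_exp.
exact: dvdn_mulr.
Qed.

(** A suitable power of a generator of the cyclic unit group. The exact multiplicative order is
    recorded because [nonconj_exists] needs it to separate an element from its inverse. *)
Lemma primitive_elt d : (d %| N)%N ->
  exists x : E, forall k, (x ^+ k == 1) = (p ^ d - 1 %| k)%N.
Proof.
move=> dN; have /cyclicP[u uE] := field_unit_group_cyclic [set: {unit E}]%G.
have ou : #[u]%g = (p ^ N - 1)%N.
  by rewrite orderE -uE card_finField_unit cardE subn1.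
have [m mE] := dvdnP (dvd_pred_exp dN).
have pN : (0 < p ^ N - 1)%N by rewrite subn_gt0 -(expn0 p) ltn_exp2l ?prime_gt1.
exists (val (u ^+ m)%g) => k.
rewrite -FinRing.val_unitX -FinRing.val_unit1 val_eqE -order_dvdn orderXdiv ou ?mE ?dvdn_mulr //.
by rewrite mulKn //; move: pN; rewrite mE muln_gt0 => /andP[].
Qed.

Lemma fdeg0 : deg 0 = 1%N.
Proof.
apply/eqP; rewrite -dvdn1 -(fix_dvd pp cardE) inE expn1 expr0n.
by rewrite -(prednK (prime_gt0 pp)).
Qed.

Lemma fdeg1 : deg 1 = 1%N.
Proof. by apply/eqP; rewrite -dvdn1 -(fix_dvd pp cardE) inE expr1n. Qed.

(** The degree of [x] divides e iff p^d - 1 divides p^e - 1. Taking e = d gives [deg x <= d], and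
    taking e = [deg x] gives the reverse inequality. *)
Lemma fdeg_primitive d x : (0 < d)%N ->
  (forall k, (x ^+ k == 1) = (p ^ d - 1 %| k)%N) -> deg x = d.
Proof.
move=> d0 xE.
have p0 k : (0 < p ^ k)%N by rewrite expn_gt0 prime_gt0.
have pd : (0 < p ^ d - 1)%N by rewrite subn_gt0 -(expn0 p) ltn_exp2l ?prime_gt1.
have x0 : x != 0.
  apply/negP=> /eqP x0; move: (dvdnn (p ^ d - 1)); rewrite -xE x0 expr0n.
  by rewrite eqn0Ngt pd /= eq_sym oner_eq0.
have fixE e : (deg x %| e)%N = (p ^ d - 1 %| p ^ e - 1)%N.
  rewrite -(fix_dvd pp cardE) -xE -[RHS](inj_eq (mulfI x0)) mulr1 -exprS.
  by rewrite subn1 prednK // inE.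
apply/eqP; rewrite eqn_dvd fixE dvdnn /=.
suff /eqP -> : d == deg x by [].
have dl : (deg x <= d)%N by apply: dvdn_leq => //; rewrite fixE.
rewrite eqn_leq dl andbT.
have := dvdnn (deg x); rewrite fixE => /dvdn_leq.
have p1 := prime_gt1 pp.
have: (1 < p ^ deg x)%N by rewrite -(expn0 p) ltn_exp2l // fdeg_gt0.
move=> h1 /(_ _); rewrite subn_gt0 => /(_ h1).
by rewrite leq_subLR subnKC // leq_exp2l.
Qed.

Lemma divisor_gt0 d : d \in D -> (0 < d)%N.
Proof. by rewrite -dvdn_divisors // => /dvdn_gt0 ->. Qed.

Lemma fdeg_onto d : d \in D -> exists x, deg x = d.
Proof.
move=> dD; have d0 := divisor_gt0 dD.
have [x xE] := primitive_elt (etrans (dvdn_divisors d N0) dD).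
by exists x; apply: fdeg_primitive.
Qed.

Lemma fdeg_divisors x : deg x \in D.
Proof. by rewrite -dvdn_divisors // (fdeg_dvdN pp cardE). Qed.

Lemma card_fixd d : d \in D -> #|K d| = (p ^ d)%N.
Proof. by case/fdeg_onto=> x <-; case: (fgen_card_fixd pp cardE x). Qed.

Lemma fixd_inj : {in D &, injective K}.
Proof.
move=> d e dD eD eK; apply/eqP; rewrite -(eqn_exp2l _ _ (prime_gt1 pp)).
by rewrite -!card_fixd // eK.
Qed.

Lemma fixd0 d : 0 \in K d.
Proof. by rewrite inE expr0n expn_eq0 eqn0Ngt prime_gt0. Qed.

Lemma fixd1 d : 1 \in K d.
Proof. by rewrite inE expr1n. Qed.

Lemma fixdM d x y : x \in K d -> y \in K d -> x * y \in K d.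
Proof. by rewrite !inE exprMn => /eqP-> /eqP->. Qed.

Lemma fixdV d x : x \in K d -> x^-1 \in K d.
Proof. by rewrite !inE exprVn => /eqP->. Qed.

(** A subfield is determined by its degree. [P] is trivial for the scalar vertices, and says that
    the degree does not divide n for field commutants. *)
Lemma card_gen_fdeg (P : pred nat) :
  #|[set gen x | x : E & P (deg x)]| = size [seq d <- D | P d].
Proof.
apply: (@card_imset_seq _ _ _ K); first by rewrite filter_uniq // divisors_uniq.
  by move=> d e; rewrite !mem_filter => /andP[_ dD] /andP[_ eD]; apply: fixd_inj.
move=> A; apply/imsetP/mapP=> [[x]|[d]].
  rewrite inE => Px ->; exists (deg x); last exact: gen_fdeg pp cardE x.
  by rewrite mem_filter Px fdeg_divisors.
rewrite mem_filter => /andP[Pd /fdeg_onto[x xd]] ->.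
by exists x; rewrite ?inE ?xd // (gen_fdeg pp cardE) xd.
Qed.

Lemma fconnect_frobP a b :
  reflect (exists2 j, (j < deg a)%N & b = a ^+ (p ^ j)) (fconnect fr a b).
Proof.
apply: (iffP idP) => [ab|[j _ ->]]; last by rewrite -iter_frob fconnect_iter.
by exists (findex fr a b); [exact: findex_max | rewrite -iter_frob iter_findex].
Qed.

Lemma fconnect_fdeg a b : fconnect fr a b -> deg a = deg b.
Proof.
have dvd x y : fconnect fr x y -> (deg y %| deg x)%N.
  case/fconnect_frobP=> j _ ->; rewrite -(fix_dvd pp cardE) inE exprAC.
  by have := fdeg_fix pp cardE x; rewrite inE => /eqP->.
move=> ab; apply/eqP; rewrite eqn_dvd !dvd //.
by rewrite fconnect_sym //; apply: frob_inj pp cardE.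
Qed.

Lemma frob_pow_inj a i j : (i < deg a)%N -> (j < deg a)%N ->
  a ^+ (p ^ i) = a ^+ (p ^ j) -> i = j.
Proof.
move=> li lj e; apply/eqP.
rewrite -(nth_uniq a _ _ (orbit_uniq fr a)) ?size_orbit //.
by rewrite /fingraph.orbit !nth_traject // !iter_frob e.
Qed.

(** Conjugates have equal degrees, so only [d = e] requires a construction. The excluded case is
    that of [conj_deg2]. *)
Lemma nonconj_exists d e : d \in D -> e \in D ->
  ~~ [&& p == 2, d == 2 & e == 2] ->
  exists x y, [/\ deg x = d, deg y = e & ~~ fconnect fr x y].
Proof.
move=> dD eD; have [->|de _] := eqVneq d e; last first.
  have [[x xd] [y ye]] := (fdeg_onto dD, fdeg_onto eD).
  exists x, y; split=> //; apply: contra de => xy.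
  by rewrite -xd -ye (fconnect_fdeg xy).
move: eD => {dD d} /[dup] /divisor_gt0 d0 dD d2.
have [d1|dn1] := eqVneq e 1%N.
  exists 0, 1; split; rewrite ?fdeg0 ?fdeg1 //.
  apply/fconnect_frobP=> -[j _ /eqP]; rewrite expr0n expn_eq0 eqn0Ngt prime_gt0 //=.
  by rewrite oner_eq0.
have [x xE] := primitive_elt (etrans (dvdn_divisors e N0) dD).
have xd : deg x = e by apply: fdeg_primitive.
exists x, x^-1; split => //.
  apply/eqP; rewrite -xd eqn_dvd -!(fix_dvd pp cardE).
  rewrite fixdV ?(fdeg_fix pp cardE) //= -{1}(invrK x) fixdV //.
  exact: (fdeg_fix pp cardE).
have x0 : x != 0 by apply: contraNneq dn1 => x0; rewrite -xd x0 fdeg0.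
apply/fconnect_frobP=> -[j]; rewrite xd => lj xV.
(* If [x^-1] were a conjugate, p^e - 1 would divide p^j + 1 with j < e, hence (p - 1) p^(e-1) <= 2.
   As e > 1, this leaves only p = e = 2. *)
have: x ^+ (p ^ j).+1 == 1 by rewrite exprS -xV divff.
rewrite xE => /(dvdn_leq (ltn0Sn _)).
have le : (p ^ j <= p ^ e.-1)%N by rewrite leq_exp2l ?prime_gt1 // -ltnS prednK.
have p1 := prime_gt1 pp.
have pe : (p ^ e = p * p ^ e.-1)%N by rewrite -expnS prednK.
have e1 : (p <= p ^ e.-1)%N.
  by rewrite -{1}(expn1 p) leq_exp2l // -ltnS prednK // ltn_neqAle eq_sym dn1.
have [p2|pn2] := eqVneq p 2.
  have : (4 <= p ^ e.-1)%N.
    have e2 : (2 <= e.-1)%N.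
      by move: d2 dn1 d0; rewrite p2 eqxx /= andbb => /eqP + /eqP; lia.
    by rewrite p2 -[4%N]/(2 ^ 2)%N leq_exp2l.
  by rewrite pe p2 in le *; move: (2 ^ j)%N (2 ^ e.-1)%N le => u v; lia.
have p3 : (3 <= p)%N by rewrite ltn_neqAle eq_sym pn2.
rewrite pe; move: (p ^ j)%N (p ^ e.-1)%N le e1 => u v; nia.
Qed.

(** Both elements are roots of z^2 + z + 1, whose roots are [x] and its Frobenius image [x ^+ 2]. *)
Lemma conj_deg2 x y : p = 2 -> deg x = 2 -> deg y = 2 -> fconnect fr x y.
Proof.
move=> p2 xd yd.
have key z : deg z = 2 -> z ^+ 2 + z + 1 = 0.
  move=> zd; have z0 : z != 0.
    by apply/negP=> /eqP z0; move: zd; rewrite z0 fdeg0.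
  have z1 : z != 1 by apply/negP=> /eqP z1; move: zd; rewrite z1 fdeg1.
  have := fdeg_fix pp cardE z; rewrite inE zd p2 => /eqP z4.
  have e : z * (z - 1) * (z ^+ 2 + z + 1) = 0 by transitivity (z ^+ 4 - z); [ring | rewrite z4 subrr].
  by move/eqP: e; rewrite !mulf_eq0 subr_eq0 (negPf z0) (negPf z1) => /eqP.
have kx := key _ xd; have ky := key _ yd.
have /eqP : (y - x) * (y - x ^+ 2) = 0.
  transitivity ((y ^+ 2 + y + 1) - (x ^+ 2 + x + 1) * (y - x + 1)); last by rewrite kx ky mul0r subrr.
  ring.
rewrite mulf_eq0 !subr_eq0 => /orP[] /eqP ->; first exact: connect0.
by have := fconnect1 fr x; rewrite /frob p2.
Qed.

End FrobeniusDegree.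

(** * Subrings of F x F *)

HB.instance Definition _ (R S : finNzRingType) := Finite.on (R * S)%type.

Section CountSubrings.
Variables (p N : nat) (E : finFieldType).
Hypotheses (pp : prime p) (N0 : (0 < N)%N) (cardE : #|E| = (p ^ N)%N).
Implicit Types x y a b : E.
Local Notation fr := (@frob p E).
Local Notation deg := (@fdeg p E).
Local Notation K := (@fixd p E).
Local Notation D := (divisors N).

Lemma horner_pair (q : {poly int}) (z : E * E) :
  (map_poly intr q).[z] = ((map_poly intr q).[z.1], (map_poly intr q).[z.2]).
Proof.
by rewrite [LHS]surjective_pairing -(horner_int_morph fst) -(horner_int_morph snd).
Qed.

Definition frob_graph (d j : nat) : {set E * E} :=
  [set (x, x ^+ (p ^ j)) | x in K d].

Lemma gen_pair_conj a j :
  gen (a, a ^+ (p ^ j)) = frob_graph (deg a) j.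
Proof.
rewrite /frob_graph -(gen_fdeg pp cardE); apply/setP=> z.
apply/genP/imsetP=> [[q ->]|[_ /genP[q ->] ->]].
  exists (map_poly intr q).[a]; first by apply/genP; exists q.
  by rewrite horner_pair (iter_horner_int pp cardE).
by exists q; rewrite horner_pair (iter_horner_int pp cardE).
Qed.

(** The orbits of [a] and [b] are disjoint, so they provide [deg a + deg b] distinct points. Codes
    of that length are separated by their values at [(a, b)], and the subring fills the product. *)
Lemma gen_pair_nonconj a b : ~~ fconnect fr a b ->
  gen (a, b) = setX (K (deg a)) (K (deg b)).
Proof.
move=> nab; apply/eqP; rewrite eqEcard; apply/andP; split.
  apply/subsetP=> _ /genP[q ->]; rewrite horner_pair in_setX /=.
  by rewrite -!(gen_fdeg pp cardE); apply/andP; split; apply/genP; exists q.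
rewrite cardsX !(proj2 (fgen_card_fixd pp cardE _)) -expnD.
pose m := (deg a + deg b)%N.
pose f (c : {ffun 'I_m -> 'I_p}) := (map_poly intr (poly_code c)).[(a, b)] : E * E.
have fi : injective f.
  move=> c c'; rewrite /f !horner_pair /= => -[ea eb].
  apply: (poly_code_inj pp cardE (rs := fingraph.orbit fr a ++ fingraph.orbit fr b)).
  - rewrite cat_uniq !orbit_uniq /= andbT; apply/hasPn=> x.
    rewrite -!fconnect_orbit => bx; apply: contra nab => ax.
    rewrite (connect_trans ax) // fconnect_sym //; exact: frob_inj pp cardE.
  - by rewrite size_cat !size_orbit.
  - move=> x; rewrite mem_cat => /orP[]; exact: (horner_orbit pp cardE).
rewrite -[X in (p ^ X)%N](card_ord m) -[X in (X ^ _)%N]card_ord -card_ffun -(card_image fi).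
by apply: subset_leq_card; apply/subsetP=> _ /imageP[c _ ->]; apply/genP; exists (poly_code c).
Qed.

Lemma frob_graph_setX d e d' j : frob_graph d j <> setX (K d') (K e).
Proof.
move/setP/(_ (1, 0)); rewrite in_setX /= fixd1 fixd0 // => /imsetP[x _ [<-]].
by move/eqP; rewrite eq_sym expr1n oner_eq0.
Qed.

Lemma fdeg_dvd d x : x \in K d -> (deg x %| d)%N.
Proof. by rewrite (fix_dvd pp cardE). Qed.

(** First coordinates recover the field. The second coordinate over an element of full degree then
    recovers the exponent. *)
Lemma frob_graph_inj d e i j : d \in D -> e \in D -> (i < d)%N -> (j < e)%N ->
  frob_graph d i = frob_graph e j -> d = e /\ i = j.
Proof.
move=> dD eD id je eq.
have dvd d1 d2 k l : d1 \in D -> frob_graph d1 k = frob_graph d2 l -> (d1 %| d2)%N.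
  move=> /(fdeg_onto pp N0 cardE)[x xd] eg.
  have : (x, x ^+ (p ^ k)) \in frob_graph d2 l.
    by rewrite -eg; apply: imset_f; rewrite -xd (fdeg_fix pp cardE).
  by case/imsetP=> y yK [xy _]; rewrite -xd xy; apply: fdeg_dvd.
have de : d = e.
  by apply/eqP; rewrite eqn_dvd (dvd _ _ _ _ dD eq) (dvd _ _ _ _ eD (esym eq)).
split=> //; move: eD je eq; rewrite -{}de => _ je eq.
have [x xd] := fdeg_onto pp N0 cardE dD.
have : (x, x ^+ (p ^ i)) \in frob_graph d j.
  by rewrite -eq; apply: imset_f; rewrite -xd (fdeg_fix pp cardE).
case/imsetP=> y yK [xy e']; apply: (@frob_pow_inj p E x); rewrite ?xd //.
by rewrite e' -xy.
Qed.

Lemma fixd_setX_inj d e d' e' : d \in D -> e \in D -> d' \in D -> e' \in D ->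
  setX (K d) (K e) = setX (K d') (K e') -> (d, e) = (d', e').
Proof.
move=> dD eD dD' eD' /setP eq; congr pair; apply: (fixd_inj pp N0 cardE) => //.
  by apply/setP=> x; have := eq (x, 0); rewrite !in_setX /= !fixd0 // !andbT.
by apply/setP=> x; have := eq (0, x); rewrite !in_setX /= !fixd0.
Qed.

Lemma card_gen_pair :
  #|[set gen z | z : E * E & z.1 != z.2]| = split_count p N.
Proof.
(* [ok] discards the product F_4 x F_4, which has no single generator. *)
pose ok (de : nat * nat) := ~~ [&& p == 2, de.1 == 2 & de.2 == 2].
pose L1 := [seq (d, e) | d <- D, e <- D].
(* Exponents start at 1, since exponent 0 gives a diagonal subring, generated by pairs with equal
   coordinates. *)
pose L2 := [seq (d, j) | d <- D, j <- iota 1 d.-1].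
pose L := map inl (filter ok L1) ++ map inr L2 : seq (nat * nat + nat * nat).
pose g (c : nat * nat + nat * nat) : {set E * E} :=
  match c with inl de => setX (K de.1) (K de.2) | inr dj => frob_graph dj.1 dj.2 end.
have memL2 d j : ((d, j) \in L2) = [&& d \in D, 0 < j & j < d]%N.
  apply/allpairsPdep/and3P=> [[d' [j' [dD]]]|[dD j0 jd]].
    by rewrite mem_iota => jd [-> ->]; split=> //; move: (divisor_gt0 N0 dD); lia.
  by exists d, j; rewrite mem_iota; split=> //; lia.
have uL1 : uniq L1 by apply: allpairs_uniq; rewrite ?divisors_uniq // => -[? ?] [? ?].
rewrite (@card_imset_seq _ _ L g); first last.
- move=> A; rewrite map_cat mem_cat -!map_comp.
  apply/imsetP/orP=> [[[a b]]|].
    rewrite inE /= => nab ->; case: (boolP (fconnect fr a b)) => [ab|nc].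
      have /fconnect_frobP[j lj bE] := ab; right; apply/mapP; exists (deg a, j).
        rewrite memL2 (fdeg_divisors pp N0 cardE) lj andbT /= lt0n.
        by apply: contraNneq nab => j0; rewrite bE j0 expn0 expr1.
      by rewrite /= bE gen_pair_conj.
    left; apply/mapP; exists (deg a, deg b); last by rewrite /= gen_pair_nonconj.
    rewrite mem_filter /ok /= allpairs_f ?(fdeg_divisors pp N0 cardE) // andbT.
    apply: contra nc => /and3P[/eqP p2 /eqP ad /eqP bd].
    exact: (conj_deg2 pp cardE).
  case=> /mapP[[d e]].
    rewrite mem_filter /ok /= => /andP[de /allpairsP[[d' e'] /= [dD eD [dE eE]]]] ->.
    rewrite -{d'}dE -{e'}eE in dD eD.
    have [a [b [da eb nab]]] := nonconj_exists pp N0 cardE dD eD de.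
    exists (a, b); last by rewrite gen_pair_nonconj // da eb.
    by rewrite inE /=; apply: contraNneq nab => ->; apply: connect0.
  rewrite memL2 => /and3P[dD e0 ed] -> /=.
  have [a ad] := fdeg_onto pp N0 cardE dD.
  exists (a, a ^+ (p ^ e)); last by rewrite gen_pair_conj ad.
  rewrite inE /=; apply: contraTneq e0 => ae; rewrite -eqn0Ngt; apply/eqP.
  by apply: (@frob_pow_inj p E a); rewrite ?ad // ?expn0 ?expr1 // (leq_ltn_trans _ ed).
- move=> [[d e]|[d i]] [[d' e']|[d' i']]; rewrite !mem_cat; last 1 first.
  + case/orP=> /mapP[// [? ?] h1 [-> ->]]; case/orP=> /mapP[// [? ?] h2 [-> ->]].
    move: h1 h2; rewrite !memL2 => /and3P[dD _ id] /and3P[dD' _ id'] eq.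
    by have [-> ->] := frob_graph_inj dD dD' id id' eq.
  + case/orP=> /mapP[// [? ?] h1 [-> ->]]; case/orP=> /mapP[// [? ?] h2 [-> ->]].
    move: h1 h2; rewrite !mem_filter.
    move=> /andP[_ /allpairsP[[? ?] [/= dD eD [-> ->]]]].
    move=> /andP[_ /allpairsP[[? ?] [/= dD' eD' [-> ->]]]] eq.
    by have [-> ->] := fixd_setX_inj dD eD dD' eD' eq.
  + by move=> _ _ /esym/frob_graph_setX.
  + by move=> _ _ /frob_graph_setX.
- rewrite cat_uniq !map_inj_uniq; try by move=> ? ? [].
  rewrite filter_uniq //=; apply/andP; split.
    by apply/hasPn=> _ /mapP[x _ ->]; apply/negP=> /mapP[].
  apply: allpairs_uniq_dep => [|d _|]; rewrite ?divisors_uniq ?iota_uniq //.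
  by move=> [? ?] [? ?] _ _ [] /= -> ->.
rewrite size_cat !size_map /split_count /num_divisors /sum_divisors.
(* Each divisor d contributes d - 1 graphs. The equation is additive to avoid truncated
   subtraction. *)
have sz2 : (size L2 + size D = \sum_(d <- D) d)%N.
  rewrite size_allpairs_dep sumnE big_map -sum1_size -big_split /=.
  by apply: eq_big_seq => d /(divisor_gt0 N0) d0; rewrite size_iota addn1 prednK.
have sz1 : (size (filter ok L1) + ((p == 2) && ~~ odd N) = size D ^ 2)%N.
  rewrite size_filter expnS expn1 -(size_allpairs pair D D) -/L1 -(count_predC ok L1).
  congr (_ + _)%N; have [p2|pn2] := eqVneq p 2; last first.
    by rewrite (@eq_count _ _ pred0) ?count_pred0 // => x; rewrite /= /ok (negPf pn2).
  rewrite (@eq_count _ _ (pred1 (2, 2))%N) => [|[x y]]; last first.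
    by rewrite /= /ok p2 negbK.
  rewrite count_uniq_mem //; congr nat_of_bool; rewrite -dvdn2 /=.
  apply/idP/allpairsP=> [N2|[[x y] /= [xD _ [x2 _]]]].
    by exists (2, 2)%N; rewrite -!dvdn_divisors.
  by rewrite (dvdn_divisors _ N0) x2.
have szD : (size D <= size D ^ 2)%N by rewrite expnS expn1; case: (size D) => // k; rewrite leq_pmulr.
by case: ifP sz1 => _ /=; move: sz2; lia.
Qed.

Definition fixd_line (d : nat) (b : E) : {set E} := [set x * b | x in K d].

Lemma fixd_line_eq d b c : d \in D -> b != 0 -> c != 0 ->
  (fixd_line d c == fixd_line d b) = (c \in fixd_line d b).
Proof.
move=> dD b0 c0; apply/eqP/idP=> [<-|/imsetP[y yK cE]].
  by apply/imsetP; exists 1; rewrite ?fixd1 ?mul1r.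
have y0 : y != 0 by apply: contraNneq c0 => y0; rewrite cE y0 mul0r.
apply/setP=> z; apply/imsetP/imsetP=> -[x xK ->].
  by exists (x * y); rewrite ?fixdM // cE mulrA.
exists (x / y); first by rewrite fixdM ?fixdV.
by rewrite cE mulrA divfK.
Qed.

(** Nonzero vectors of [E] are shared out among the lines over [K d], each holding p^d - 1 of
    them. *)
Lemma card_fixd_lines d : d \in D ->
  #|[set fixd_line d b | b in [set b | b != 0]]| = ((p ^ N - 1) %/ (p ^ d - 1))%N.
Proof.
move=> dD; have d0 := divisor_gt0 N0 dD.
have pd : (0 < p ^ d - 1)%N by rewrite subn_gt0 -(expn0 p) ltn_exp2l ?prime_gt1.
have cn0 : #|[set b : E | b != 0]| = (p ^ N - 1)%N.
  rewrite -cardE -cardsT (cardsD1 0 [set: E]) in_setT add1n subn1 /=.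
  by apply: eq_card => x; rewrite !inE andbT.
rewrite -cn0 -(@card_uniform_imset _ _ (fixd_line d) _ (p ^ d - 1)) ?mulnK //.
move=> b; rewrite inE => b0.
rewrite -(card_fixd pp N0 cardE dD) (cardsD1 0 (K d)) fixd0 // add1n subn1 /=.
rewrite -[RHS](card_imset _ (mulIf b0)); apply: eq_card => c.
rewrite !inE; apply/andP/imsetP=> [[c0]|[x]].
  rewrite fixd_line_eq // => /imsetP[x xK cE]; exists x => //.
  by rewrite in_setD1 xK andbT; apply: contraNneq c0 => x0; rewrite cE x0 mul0r.
rewrite in_setD1 => /andP[x0 xK ->].
have xb : x * b != 0 by rewrite mulf_neq0.
by split=> //; rewrite fixd_line_eq //; apply: imset_f.
Qed.

(** In the basis 1, v these products are the subrings described by [gen_combine_nil]. The slices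
    through 0 recover the degree and the line. *)
Lemma card_fixd_fixd_line :
  #|[set setX (K (deg z.1)) (fixd_line (deg z.1) z.2) | z : E * E & z.2 != 0]|
  = nilpotent_count p N.
Proof.
pose L := [seq (d, B) | d <- D, B <- enum [set fixd_line d b | b in [set b | b != 0]]].
pose g (c : nat * {set E}) : {set E * E} := setX (K c.1) c.2.
have memL d B :
    ((d, B) \in L) = (d \in D) && [exists b, (b != 0) && (B == fixd_line d b)].
  apply/allpairsPdep/andP=> [[d' [B' [dD]]]|[dD /existsP[b /andP[b0 /eqP BE]]]].
    rewrite mem_enum => /imsetP[b]; rewrite inE => b0 -> [-> ->]; split=> //.
    by apply/existsP; exists b; rewrite b0 eqxx.
  by exists d, B; rewrite mem_enum BE imset_f ?inE.
rewrite (@card_imset_seq _ _ L g); first last.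
- move=> A; apply/imsetP/mapP=> [[[a b]]|[[d B]]].
    rewrite inE /= => b0 ->; exists (deg a, fixd_line (deg a) b) => //.
    by rewrite memL (fdeg_divisors pp N0 cardE); apply/existsP; exists b; rewrite b0 eqxx.
  rewrite memL => /andP[dD /existsP[b /andP[b0 /eqP ->]]] ->.
  have [a ad] := fdeg_onto pp N0 cardE dD.
  by exists (a, b); rewrite ?inE //= ad.
- move=> [d B] [d' B']; rewrite !memL.
  move=> /andP[dD /existsP[b /andP[b0 /eqP BE]]] /andP[dD' /existsP[b' /andP[b0' /eqP BE']]].
  move=> /setP eq; congr pair.
    apply: (fixd_inj pp N0 cardE) => //; apply/setP=> x; have := eq (x, 0).
    have z0 e c : 0 \in fixd_line e c by apply/imsetP; exists 0; rewrite ?fixd0 ?mul0r.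
    by rewrite !in_setX /= BE BE' !z0 !andbT.
  by apply/setP=> x; have := eq (0, x); rewrite !in_setX /= !fixd0.
- apply: allpairs_uniq_dep => [|d _|]; rewrite ?divisors_uniq ?enum_uniq //.
  by move=> [? ?] [? ?] _ _ [] /= -> ->.
rewrite size_allpairs_dep sumnE big_map; apply: eq_big_seq => d dD.
by rewrite -fintype.cardE card_fixd_lines.
Qed.

End CountSubrings.

(** * Commutants of 2x2 matrices *)

Section Matrix2.
Variable F : finFieldType.
Local Notation M := 'M[F]_2.
Implicit Types (a b e v : M) (x y : F) (z : F * F).

Lemma mulmx2E a b i j : (a * b) i j = a i 0 * b 0 j + a i 1 * b 1 j.
Proof. by rewrite mxE big_ord_recl big_ord1; congr (_ * _ + a _ _ * b _ _); apply: val_inj. Qed.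

Lemma eq_mx2 a b :
  a 0 0 = b 0 0 -> a 0 1 = b 0 1 -> a 1 0 = b 1 0 -> a 1 1 = b 1 1 -> a = b.
Proof.
have I2 (i : 'I_2) : i = 0 \/ i = 1.
  by case: i => [[|[|//]] lt]; [left|right]; apply: val_inj.
by move=> h00 h01 h10 h11; apply/matrixP=> i j; case: (I2 i) => ->; case: (I2 j) => ->.
Qed.

Definition mx2E := (mulmx2E, mxE, mulr1n, mulr0n, eqxx).

Definition scalars : {set M} := [set x%:M | x : F].

Lemma scalarsP a : reflect (exists x, a = x%:M) (a \in scalars).
Proof. by apply: (iffP imsetP) => [[x _ ->]|[x ->]]; exists x. Qed.

Lemma scalarsE a : (a \in scalars) = [&& a 0 1 == 0, a 1 0 == 0 & a 0 0 == a 1 1].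
Proof.
apply/scalarsP/and3P=> [[x ->]|[/eqP h01 /eqP h10 /eqP h]]; first by rewrite !mx2E.
by exists (a 0 0); apply: eq_mx2; rewrite !mx2E.
Qed.

Lemma card_scalars : #|scalars| = #|F|.
Proof.
rewrite card_imset ?cardT // => x y /(congr1 (fun A : M => A 0 0)).
by rewrite !mx2E.
Qed.

Lemma scalar_mulr x a : x%:M * a = x *: a.
Proof. exact: mul_scalar_mx. Qed.

Lemma scalar_mull x a : a * x%:M = x *: a.
Proof. exact: mul_mx_scalar. Qed.

Definition commutant a : {set M} := [set b | a * b == b * a].

Lemma commutantP a b : reflect (a * b = b * a) (b \in commutant a).
Proof. by rewrite inE; apply: eqP. Qed.

(** Coordinates on F[a] in the basis 1, [a] when [a] is not scalar. *)
Definition combine a (z : F * F) : M := z.1%:M + z.2 *: a.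

Lemma combine_commutant a z : combine a z \in commutant a.
Proof.
by apply/commutantP; rewrite mulrDr mulrDl scalar_mull scalar_mulr -scalerAl -scalerAr.
Qed.

(** Commutation says that the vectors (b01, b10, b00 - b11) and (a01, a10, a00 - a11) are parallel.
    The latter is nonzero for non-scalar [a], so a factor [y] is read off a nonzero entry. *)
Lemma combineP a b : a \notin scalars -> b \in commutant a ->
  exists x y, b = combine a (x, y).
Proof.
rewrite scalarsE !negb_and => na /commutantP /matrixP h.
have := (h 0 0, h 0 1, h 1 0); rewrite !mulmx2E => -[[h00 h01] h10].
have mk y : y * a 0 1 = b 0 1 -> y * a 1 0 = b 1 0 ->
    y * (a 0 0 - a 1 1) = b 0 0 - b 1 1 -> exists x y, b = combine a (x, y).
  move=> e01 e10 e; exists (b 0 0 - y * a 0 0), y; apply: eq_mx2; rewrite !mx2E /=.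
  - by ring.
  - by rewrite add0r.
  - by rewrite add0r.
  - transitivity (b 0 0 - y * (a 0 0 - a 1 1)); last by ring.
    by rewrite e; ring.
have e0 : b 0 1 * a 1 0 = a 0 1 * b 1 0.
  apply: (addrI (a 0 0 * b 0 0)); rewrite h00; ring.
have e1 : b 0 1 * (a 0 0 - a 1 1) = (b 0 0 - b 1 1) * a 0 1.
  apply/eqP; rewrite -subr_eq0; apply/eqP.
  transitivity (a 0 0 * b 0 1 + a 0 1 * b 1 1 - (b 0 0 * a 0 1 + b 0 1 * a 1 1)); first by ring.
  by rewrite h01 subrr.
have e2 : b 1 0 * (a 0 0 - a 1 1) = (b 0 0 - b 1 1) * a 1 0.
  apply/eqP; rewrite -subr_eq0; apply/eqP.
  transitivity (- (a 1 0 * b 0 0 + a 1 1 * b 1 0 - (b 1 0 * a 0 0 + b 1 1 * a 1 0))); first by ring.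
  by rewrite h10 subrr oppr0.
have solve (x y x' y' : F) : x != 0 -> y' * x' = y * x -> y' / x * x' = y.
  by move=> x0 e; apply: (mulIf x0); rewrite mulrAC divfK.
case/or3P: na => n0; last rewrite -subr_eq0 in n0.
- apply: (mk (b 0 1 / a 0 1)); apply: solve => //.
  by rewrite e0 mulrC.
- apply: (mk (b 1 0 / a 1 0)); apply: solve => //.
  by rewrite e0 mulrC.
- apply: (mk ((b 0 0 - b 1 1) / (a 0 0 - a 1 1))); exact: solve.
Qed.

Lemma combine_inj a : a \notin scalars -> injective (combine a).
Proof.
move=> na [x y] [x' y'] /eqP; rewrite /combine /= -subr_eq0 => /eqP h.
have yy : y = y'.
  apply/eqP; apply: contraNT na => ny; rewrite -subr_eq0 in ny.
  apply/scalarsP; exists ((x' - x) / (y - y')).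
  apply: (scalerI ny); rewrite scale_scalar_mx mulrCA divff // mulr1.
  apply/eqP; rewrite -subr_eq0 -[X in _ == X]h; apply/eqP.
  by rewrite raddfB scalerBl; apply/matrixP=> i j; rewrite !mxE; ring.
move: h; rewrite {}yy opprD addrACA subrr addr0 -raddfB /= => /matrixP/(_ 0 0).
by rewrite !mx2E => /eqP; rewrite subr_eq0 => /eqP ->.
Qed.

Lemma combine_scalar a z : a \notin scalars -> (combine a z \in scalars) = (z.2 == 0).
Proof.
move=> na; apply/scalarsP/eqP=> [[x]|e0]; last by exists z.1; rewrite /combine e0 scale0r addr0.
have -> : x%:M = combine a (x, 0) by rewrite /combine scale0r addr0.
by move/(combine_inj na) ->.
Qed.

Lemma commutantE a : a \notin scalars -> commutant a = combine a @: setT.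
Proof.
move=> na; apply/setP=> b; apply/idP/imsetP=> [/(combineP na)[x [y ->]]|[z _ ->]].
  by exists (x, y).
exact: combine_commutant.
Qed.

Lemma card_commutant a : a \notin scalars -> #|commutant a| = (#|F| ^ 2)%N.
Proof.
move=> na; rewrite commutantE // card_imset ?cardsT ?card_prod ?mulnn //.
exact: combine_inj.
Qed.

Lemma scalars_commutant a : scalars \subset commutant a.
Proof.
by apply/subsetP=> _ /scalarsP[x ->]; apply/commutantP; rewrite scalar_mull scalar_mulr.
Qed.

Lemma commutant_scalar a : a \in scalars -> commutant a = setT.
Proof.
case/scalarsP=> x ->; apply/setP=> b; rewrite in_setT; apply/commutantP.
by rewrite scalar_mull scalar_mulr.
Qed.

(** Here [b] is [x + y a] with [y != 0], so commuting with [b] forces commuting with [a]. Equal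
    cardinalities finish. *)
Lemma commutant_eq a b : a \notin scalars -> b \notin scalars ->
  b \in commutant a -> commutant b = commutant a.
Proof.
move=> na nb ba; apply/eqP; rewrite eqEcard !card_commutant // leqnn andbT.
have [x [y E]] := combineP na ba.
have y0 : y != 0 by move: nb; rewrite E combine_scalar.
apply/subsetP=> c /commutantP; rewrite E /combine /= mulrDl mulrDr scalar_mulr scalar_mull.
by move/addrI; rewrite -scalerAl -scalerAr => /(scalerI y0) ac; apply/commutantP.
Qed.

Lemma commutant_eqE a b : a \notin scalars -> b \notin scalars ->
  (commutant b == commutant a) = (b \in commutant a).
Proof.
move=> na nb; apply/eqP/idP=> [<-|]; last exact: commutant_eq.
by apply/commutantP.
Qed.

(** * Number of commutants of each type *)

Definition idempotents : {set M} := [set e | e * e == e] :\: scalars.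
(** For 2x2 matrices nilpotent means square zero, and the only scalar removed is 0. *)
Definition nilpotents : {set M} := [set v | v * v == 0] :\: scalars.

(** If the first factor is nonzero it determines the second. If it is 0, then [f] vanishes and the
    second factor is free. *)
Lemma card_hyperbolas (f : F -> F) :
  #|[set w : F * (F * F) | w.2.1 * w.2.2 == f w.1]|
  = (#|F| * (#|F| - 1) + #|[set x | f x == 0%R]| * #|F|)%N.
Proof.
set W := [set w : F * (F * F) | _]; rewrite -(cardsID [set w : F * (F * F) | w.2.1 == 0] W) addnC.
have cn0 : #|[set b : F | b != 0]| = (#|F| - 1)%N.
  rewrite -cardsT (cardsD1 0 [set: F]) in_setT add1n subn1 /=.
  by apply: eq_card => x; rewrite !inE andbT.
congr (_ + _)%N.
  rewrite -cn0 -cardsT -cardsX.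
  rewrite -(@card_in_imset _ _ (fun z : F * F => (z.1, (z.2, f z.1 / z.2)))).
    apply: eq_card => -[x [y z]]; rewrite !inE /=; apply/andP/imsetP=> [[y0 /eqP yz]|[[x' y']]].
      by exists (x, y); rewrite ?inE //= -yz mulrAC divff // mul1r.
    by rewrite !inE /= => y0 [-> -> ->]; rewrite mulrC divfK.
  by move=> [? ?] [? ?] _ _ [-> ->].
rewrite -[#|F|]cardsT -cardsX.
rewrite -(@card_in_imset _ _ (fun z : F * F => (z.1, (0 : F, z.2)))).
  apply: eq_card => -[x [y z]]; rewrite !inE /=; apply/andP/imsetP=> [[fx /eqP y0]|[[x' y']]].
    by exists (x, z); rewrite ?inE /= ?y0 // -(eqP fx) y0 mul0r eqxx.
  by rewrite !inE /= andbT => fx [-> -> ->]; rewrite eqxx mul0r eq_sym.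
by move=> [? ?] [? ?] _ _ [-> ->].
Qed.

(** Coordinates on the matrices of trace [t]. *)
Definition mk_mx2 (t : F) (w : F * (F * F)) : M :=
  \matrix_(i, j) if i == 0 then if j == 0 then w.1 else w.2.1
                 else if j == 0 then w.2.2 else t - w.1.

Lemma mk_mx2_inj t : injective (mk_mx2 t).
Proof.
move=> [x [y z]] [x' [y' z']] /matrixP h.
by have := (h 0 0, h 0 1, h 1 0); rewrite !mxE /= => -[[-> ->] ->].
Qed.

Lemma mk_mx2_eta a : a = mk_mx2 (a 0 0 + a 1 1) (a 0 0, (a 0 1, a 1 0)).
Proof. by apply: eq_mx2; rewrite !mxE /= //; ring. Qed.

(** A non-scalar idempotent has trace 1 and determinant 0. The equation on [w] is the vanishing of
    the determinant. *)
Lemma idempotentsE :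
  idempotents = mk_mx2 1 @: [set w | w.2.1 * w.2.2 == w.1 * (1 - w.1)].
Proof.
apply/setP=> e; rewrite inE scalarsE inE; apply/andP/imsetP.
  move=> [ne /eqP/matrixP h]; have := (h 0 0, h 0 1, h 1 0, h 1 1).
  rewrite !mulmx2E => -[[[h00 h01] h10] h11].
  have t1 : e 0 0 + e 1 1 = 1.
    have [b0|b0] := eqVneq (e 0 1) 0; last first.
      by apply: (mulfI b0); rewrite mulr1 -[RHS]h01; ring.
    have [c0|c0] := eqVneq (e 1 0) 0; last first.
      by apply: (mulfI c0); rewrite mulr1 -[RHS]h10; ring.
    move: ne; rewrite b0 c0 !eqxx /= -subr_eq0 => n0; apply: (mulfI n0).
    transitivity (e 0 0 * e 0 0 + e 0 1 * e 1 0 - (e 1 0 * e 0 1 + e 1 1 * e 1 1)).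
      by rewrite b0; ring.
    by rewrite h00 h11 mulr1.
  exists (e 0 0, (e 0 1, e 1 0)); last by rewrite -t1 -mk_mx2_eta.
  rewrite inE /= mulrBr mulr1 eq_sym subr_eq addrC; apply/eqP; exact: esym h00.
move=> [[x [b c]]]; rewrite inE /= => /eqP bc ->; rewrite !mxE /=; split.
  apply/negP=> /and3P[/eqP b0 /eqP c0 /eqP xx]; move: bc; rewrite b0 mul0r -xx => /esym/eqP.
  by rewrite mulf_eq0 orbb => /eqP x0; move: xx; rewrite x0 subr0 => /eqP; rewrite eq_sym oner_eq0.
apply/eqP; apply: eq_mx2; rewrite mulmx2E !mxE /= ?bc; try ring.
by rewrite mulrC bc; ring.
Qed.

(** Now both trace and determinant are 0, and the zero matrix is the only scalar to discard, in
    every characteristic. *)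
Lemma nilpotentsE :
  nilpotents = mk_mx2 0 @: ([set w | w.2.1 * w.2.2 == - (w.1 * w.1)] :\ (0, (0, 0))).
Proof.
apply/setP=> e; rewrite inE scalarsE inE; apply/andP/imsetP.
  move=> [ne /eqP/matrixP h]; have := (h 0 0, h 0 1, h 1 0, h 1 1).
  rewrite !mulmx2E !mxE => -[[[h00 h01] h10] h11].
  have t1 : e 0 0 + e 1 1 = 0.
    have [b0|b0] := eqVneq (e 0 1) 0; last first.
      by apply: (mulfI b0); rewrite mulr0 -[RHS]h01; ring.
    have [c0|c0] := eqVneq (e 1 0) 0; last first.
      by apply: (mulfI c0); rewrite mulr0 -[RHS]h10; ring.
    move: ne; rewrite b0 c0 !eqxx /= -subr_eq0 => n0; apply: (mulfI n0).
    transitivity (e 0 0 * e 0 0 + e 0 1 * e 1 0 - (e 1 0 * e 0 1 + e 1 1 * e 1 1)).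
      by rewrite b0; ring.
    by rewrite h00 h11 subrr mulr0.
  exists (e 0 0, (e 0 1, e 1 0)); last by rewrite -t1 -mk_mx2_eta.
  rewrite !inE /= -addr_eq0 addrC h00 eqxx andbT.
  apply: contra ne => /eqP[x0 b0 c0]; rewrite b0 c0 !eqxx x0 /=.
  by move: t1; rewrite x0 add0r => ->.
move=> [[x [b c]]]; rewrite !inE /= => /andP[n0 /eqP bc] ->; rewrite !mxE /=; split.
  apply: contra n0 => /and3P[/eqP b0 /eqP c0 _]; move: bc; rewrite b0 c0 mul0r.
  by move=> /esym/eqP; rewrite oppr_eq0 mulf_eq0 orbb => /eqP ->.
apply/eqP; apply: eq_mx2; rewrite mulmx2E !mxE /= ?bc; try ring.
by rewrite mulrC bc; ring.
Qed.

Lemma card_idempotents : #|idempotents| = (#|F| ^ 2 + #|F|)%N.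
Proof.
rewrite idempotentsE card_imset; last exact: mk_mx2_inj.
rewrite (card_hyperbolas (fun x => x * (1 - x))).
have -> : [set x : F | x * (1 - x) == 0] = [set 0; 1].
  by apply/setP=> x; rewrite !inE mulf_eq0 subr_eq0 [1 == x]eq_sym.
rewrite cards2 eq_sym oner_eq0; have := finNzRing_gt1 F.
by case: #|F| => // q _; lia.
Qed.

Lemma card_nilpotents : #|nilpotents| = (#|F| ^ 2 - 1)%N.
Proof.
rewrite nilpotentsE card_imset; last exact: mk_mx2_inj.
have := card_hyperbolas (fun x : F => - (x * x)).
have -> : [set x : F | - (x * x) == 0] = [set 0].
  by apply/setP=> x; rewrite !inE oppr_eq0 mulf_eq0 orbb.
rewrite cards1 (cardsD1 (0, (0, 0))) inE /= !mul0r oppr0 eqxx add1n => h.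
have := finNzRing_gt1 F; rewrite mul1n -mulnn in h *; move: h.
by set c := #|_|; case: #|F| => // q; nia.
Qed.

(** One relation for several cases: c = 1 for idempotents and c = 0 for nilpotents. Its corollary
    [combine_sqr] is also applied to a singular matrix, with c its trace. *)
Lemma combineM a (c x y x' y' : F) : a * a = c *: a ->
  combine a (x, y) * combine a (x', y')
  = combine a (x * x', x * y' + y * x' + c * (y * y')).
Proof.
move=> aa; rewrite /combine /= mulrDl scalar_mulr -scalerAl mulrDr scalar_mull -scalerAr aa.
by apply/matrixP=> i j; rewrite !mxE; ring.
Qed.

Lemma combine_sqr a (c x y : F) : a * a = c *: a ->
  combine a (x, y) * combine a (x, y) = combine a (x * x, (x + x + c * y) * y).
Proof. by move/combineM->; congr (combine a (_, _)); ring. Qed.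

(** F[e] has the idempotents 0, 1, e and 1 - e, of which the first two are scalar. *)
Lemma combine_idem e x y : e \in idempotents -> (combine e (x, y) \in idempotents) =
  (x == 0) && (y == 1) || (x == 1) && (y == -1).
Proof.
rewrite inE => /andP[ne]; rewrite inE => /eqP ee.
rewrite inE combine_scalar //= inE.
rewrite (@combine_sqr _ 1) ?scale1r // mul1r.
rewrite (inj_eq (combine_inj ne)) xpair_eqE.
have [->|y0] /= := eqVneq y 0.
  by rewrite ![0 == _]eq_sym oner_eq0 oppr_eq0 oner_eq0 !andbF.
rewrite -[X in _ && (_ == X)]mul1r (inj_eq (mulIf y0)).
rewrite -subr_eq0 -[X in _ * _ - X]mulr1 -mulrBr mulf_eq0 subr_eq0.
have [->|x0] /= := eqVneq x 0.
  by rewrite !add0r [0 == 1]eq_sym oner_eq0 orbF.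
by have [->|] //= := eqVneq x 1; rewrite -addrA -[X in _ == X]addr0 (inj_eq (addrI 1)) addrC addr_eq0.
Qed.

Lemma combine_nilp v x y : v \in nilpotents ->
  (combine v (x, y) \in nilpotents) = (x == 0) && (y != 0).
Proof.
rewrite inE => /andP[nv]; rewrite inE => /eqP vv.
rewrite inE combine_scalar //= inE.
rewrite (@combine_sqr _ 0) ?scale0r // mul0r addr0.
have -> : 0 = combine v (0, 0) by rewrite /combine scale0r raddf0 addr0.
rewrite (inj_eq (combine_inj nv)) xpair_eqE mulf_eq0 orbb andbC.
by have [->|] //= := eqVneq x 0; rewrite addr0 mul0r eqxx.
Qed.

Definition split_classes := commutant @: idempotents.
Definition nil_classes := commutant @: nilpotents.
(** A complement, hence counted by subtraction. [nonsplit_no_root] is what makes these commutants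
    fields. *)
Definition nonsplit_classes :=
  (commutant @: ~: scalars) :\: (split_classes :|: nil_classes).

Lemma fiber_commutant (S : {set M}) a : a \notin scalars -> [disjoint S & scalars] ->
  [set b in S | commutant b == commutant a] = [set combine a z | z in [set z | combine a z \in S]].
Proof.
move=> na dS; apply/setP=> b; rewrite inE; apply/andP/imsetP=> [[bS]|[z]].
  rewrite commutant_eqE // ?(disjointFr dS bS) // => /(combineP na)[x [y E]].
  by exists (x, y); rewrite ?inE -?E.
by rewrite inE => zS ->; rewrite zS commutant_eqE ?combine_commutant ?(disjointFr dS zS).
Qed.

Lemma card_split_classes : #|split_classes| = ((#|F| ^ 2 + #|F|) %/ 2)%N.
Proof.
rewrite -card_idempotents -(@card_uniform_imset _ _ commutant idempotents 2) ?mulnK // => e eI.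
have ne : e \notin scalars by move: eI; rewrite inE => /andP[].
rewrite fiber_commutant //; last by rewrite disjoints_subset subsetDr.
rewrite card_imset; last exact: combine_inj.
transitivity #|[set (0 : F, 1 : F); (1, -1)]|; last by rewrite cards2 xpair_eqE eq_sym oner_eq0.
by apply: eq_card => -[x y]; rewrite inE combine_idem // !inE !xpair_eqE.
Qed.

Lemma card_nil_classes : #|nil_classes| = (#|F| + 1)%N.
Proof.
have q1 := finNzRing_gt1 F.
have h : (#|nil_classes| * (#|F| - 1) = #|F| ^ 2 - 1)%N.
  rewrite -card_nilpotents; apply: card_uniform_imset => v vN.
  have nv : v \notin scalars by move: vN; rewrite inE => /andP[].
  rewrite fiber_commutant //; last by rewrite disjoints_subset subsetDr.
  rewrite card_imset; last exact: combine_inj.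
  rewrite -[#|F|]cardsT (cardsD1 0 [set: F]) in_setT add1n subn1 /=.
  have /card_imset <- : injective (fun y : F => (0 : F, y)) by move=> ? ? [].
  apply: eq_card => -[x y]; rewrite inE combine_nilp //; apply/andP/imsetP=> [[/eqP -> y0]|[z]].
    by exists y; rewrite ?inE ?y0.
  by rewrite !inE andbT => z0 [-> ->].
have q0 : (0 < #|F| - 1)%N by rewrite subn_gt0.
apply/eqP; rewrite -(eqn_pmul2r q0) h; apply/eqP.
by rewrite -{2}(exp1n 2) subn_sqr mulnC.
Qed.

(** The q^4 - q non-scalar matrices are partitioned by commutant, with q^2 - q in each. *)
Lemma card_all_classes : #|commutant @: ~: scalars| = (#|F| ^ 2 + #|F| + 1)%N.
Proof.
have q1 := finNzRing_gt1 F.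
have h : (#|commutant @: ~: scalars| * (#|F| ^ 2 - #|F|) = #|F| ^ 4 - #|F|)%N.
  transitivity #|~: scalars|; last first.
    by have := cardsC scalars; rewrite card_scalars card_mx; move: #|F| #|~: _| => q c <-; rewrite addKn.
  apply: card_uniform_imset => a; rewrite inE => na.
  rewrite -(card_commutant na) -card_scalars -cardsDS ?scalars_commutant //.
  apply: eq_card => b; rewrite !inE -!/(is_true _); case: (boolP (b \in scalars)) => //= nb.
  by rewrite commutant_eqE // inE.
have q0 : (0 < #|F| ^ 2 - #|F|)%N by rewrite subn_gt0 -{1}(expn1 #|F|) ltn_exp2l.
apply/eqP; rewrite -(eqn_pmul2r q0) h; apply/eqP.
have : (#|F| <= #|F| ^ 2)%N by rewrite -{1}(expn1 #|F|) leq_exp2l.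
have : (#|F| <= #|F| ^ 4)%N by rewrite -{1}(expn1 #|F|) leq_exp2l.
by move: #|F| => q; nia.
Qed.

(** F[e] is isomorphic to F x F, which has no nonzero nilpotent. *)
Lemma split_nil_disjoint : [disjoint split_classes & nil_classes].
Proof.
apply/pred0P=> A /=; apply/negbTE/negP=> /andP[/imsetP[e eI ->] /imsetP[v vN] ev].
have /andP[ne /[!inE] /eqP ee] : (e \notin scalars) && (e \in [set e | e * e == e]) by rewrite -in_setD.
have : v \in commutant e by rewrite ev inE.
case/(combineP ne)=> x [y vE].
have nv : v \notin scalars by move: vN; rewrite inE => /andP[].
have : v * v == 0 by move: vN; rewrite !inE => /andP[].
have y0 : y != 0 by move: nv; rewrite vE combine_scalar.
rewrite vE (@combine_sqr _ 1) ?scale1r // mul1r.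
have -> : 0 = combine e (0, 0) by rewrite /combine scale0r raddf0 addr0.
rewrite (inj_eq (combine_inj ne)) xpair_eqE !mulf_eq0 orbb (negPf y0) orbF.
by case/andP=> /eqP ->; rewrite !add0r (negPf y0).
Qed.

Lemma card_nonsplit_classes : #|nonsplit_classes| = ((#|F| ^ 2 - #|F|) %/ 2)%N.
Proof.
have sub (S : {set M}) : [disjoint S & scalars] -> commutant @: S \subset commutant @: ~: scalars.
  by move=> dS; apply: imsetS; rewrite -disjoints_subset.
rewrite cardsDS ?subUset ?sub ?disjoints_subset ?subsetDr //.
rewrite cardsU (disjoint_setI0 split_nil_disjoint) cards0 subn0.
rewrite card_all_classes card_split_classes card_nil_classes.
(* With q^2 - q = 2k, the split classes number k + q, so both halves are exact. *)
have /dvdnP[k] : (2 %| #|F| ^ 2 - #|F|)%N.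
  by rewrite dvdn2 oddB ?oddX ?addbb // -{1}(expn1 #|F|) leq_exp2l // finNzRing_gt1.
have : (#|F| <= #|F| ^ 2)%N by rewrite -{1}(expn1 #|F|) leq_exp2l // finNzRing_gt1.
move: #|F| => q qq kE; rewrite kE mulnK //.
have -> : (q ^ 2 + q = (k + q) * 2)%N by lia.
by rewrite mulnK //; lia.
Qed.

End Matrix2.

(** * Subrings in one commutant *)

Section Fibers.
Variables (n p : nat) (F : finFieldType).
Hypotheses (n0 : (0 < n)%N) (pp : prime p) (cardF : #|F| = (p ^ n)%N).
Local Notation M := 'M[F]_2.
Implicit Types (a b e v : M).
Local Notation scalars := (scalars F).

Definition fiber a : {set {set M}} := [set gen b | b in commutant a :\: scalars].

(** Moves the count to a model of the commutant: F x F, or the field with q^2 elements. *)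
Lemma card_fiber_morph (B : finNzRingType) (phi : B -> M) a :
  injective phi -> zmod_morphism phi -> monoid_morphism phi ->
  phi @: setT = commutant a ->
  #|fiber a| = #|[set gen z | z : B & phi z \notin scalars]|.
Proof.
move=> phiI phiB phiM im; rewrite -(card_imset _ (imset_inj phiI)) /fiber -im.
congr #|pred_of_set _|; apply/setP=> A; apply/imsetP/imsetP.
  case=> b /setDP[/imsetP[z _ ->] nz] ->; exists (gen z); last exact: gen_morph.
  by apply: imset_f; rewrite inE.
case=> _ /imsetP[z nz ->] ->; exists (phi z); last by rewrite -gen_morph.
by rewrite inE in nz; rewrite inE nz; apply: imset_f.
Qed.

Lemma card_gen_scalars : #|[set gen a | a in scalars]| = num_divisors n.
Proof.
have fB : zmod_morphism (scalar_mx : F -> M) by move=> x y; rewrite raddfB.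
have fM : monoid_morphism (scalar_mx : F -> M).
  by split=> // x y; rewrite scalar_mxM.
have fI : injective (scalar_mx : F -> M).
  by move=> x y /(congr1 (fun A : M => A 0 0)); rewrite !mx2E.
rewrite /num_divisors -[divisors n](filter_predT).
rewrite -(card_gen_fdeg pp n0 cardF predT) -(card_imset _ (imset_inj fI)).
congr #|pred_of_set _|; apply/setP=> A; apply/imsetP/imsetP.
  case=> _ /scalarsP[x ->] ->; exists (gen x); last exact: gen_morph.
  by apply/imsetP; exists x; rewrite ?inE.
by case=> _ /imsetP[x _ ->] ->; exists x%:M; rewrite ?(gen_morph x fB fM) //; apply/scalarsP; exists x.
Qed.

Lemma card_fiber_split e : e \in idempotents F -> #|fiber e| = split_count p n.
Proof.
rewrite inE => /andP[ne]; rewrite inE => /eqP ee.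
(* This is (s, t) mapped to s e + t (1 - e), rewritten in the basis 1, e. It is scalar iff s = t. *)
pose phi (z : F * F) := combine e (z.2, z.1 - z.2).
have phiI : injective phi.
  by move=> [x y] [x' y'] /(combine_inj ne) /= -[->] /addIr ->.
rewrite -(card_gen_pair pp n0 cardF) (@card_fiber_morph _ phi e phiI).
- congr #|pred_of_set _|; apply/setP=> A; apply/imsetP/imsetP=> -[z zP ->]; exists z => //.
    by move: zP; rewrite !inE /phi combine_scalar // subr_eq0.
  by move: zP; rewrite !inE /phi combine_scalar // subr_eq0.
- move=> [x y] [x' y']; rewrite /phi /combine /=.
  by apply/matrixP=> i j; rewrite !mxE; ring.
- split; first by rewrite /phi /combine /= subrr scale0r addr0.
  move=> [x y] [x' y']; rewrite /phi (@combineM _ _ 1) ?scale1r //=.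
  by congr (combine e (_, _)); ring.
- rewrite commutantE //; apply/setP=> b; apply/imsetP/imsetP=> -[[x y] _ ->].
    by exists (y, x - y).
  by exists (x + y, x); rewrite // /phi /= addrC addKr.
Qed.

Lemma gen_combine_nil v (x y : F) : v \in nilpotents F -> y != 0 ->
  gen (combine v (x, y)) =
  combine v @: setX (fixd p F (fdeg p x)) (fixd_line p (fdeg p x) y).
Proof.
rewrite inE => /andP[nv]; rewrite inE => /eqP vv y0.
have vv0 : v * v = 0 *: v by rewrite scale0r.
set d := fdeg p x; set a := combine v (x, y).
have [g1 gB gM] := gen_subring_closed a.
have sc_gen z : z \in fixd p F d -> z%:M \in gen a.
  have xa : x%:M \in gen a.
    (* The binomial formula cut off by [v * v = 0]. At k = q the second coordinate is a multiple of
       p and [x ^+ q = x], so the scalar [x] is a power of [a]. *)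
    have powE k : a ^+ k = combine v (x ^+ k, (x ^+ k.-1 * y) *+ k).
      elim: k => [|k IH]; first by rewrite expr0 mulr0n /combine scale0r addr0.
      rewrite exprS IH (combineM _ _ _ _ vv0) mul0r addr0 -exprS; congr (combine v (_, _)).
      case: k {IH} => [|k] /=; first by rewrite mulr0n mulr0 add0r expr0 mulr1 mul1r.
      by rewrite -mulrnAr mulrA -exprS [RHS]mulrSr mulrnAr [y * _]mulrC.
    have := powE (p ^ n)%N; rewrite -cardF expf_card -(mulr_natr _ #|F|) cardF natrX.
    rewrite (pcharf0 (pcharE pp cardF)) expr0n eqn0Ngt n0 mulr0 /combine scale0r addr0 => <-.
    by elim: (p ^ n)%N => [|k IH]; rewrite ?expr0 // exprS gM // gen_self.
  have fM : monoid_morphism (scalar_mx : F -> M) by split=> // ? ?; rewrite scalar_mxM.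
  rewrite -(gen_fdeg pp cardF) => zx; apply: (gen_sub (gen_subring_closed a) xa).
  by rewrite gen_morph ?imset_f // => ? ?; rewrite raddfB.
apply/eqP; rewrite eqEsubset; apply/andP; split; apply/subsetP.
  have [k1 kB kM] := fixd_subring_closed pp cardF d.
  apply: gen_sub.
    split.
    - apply/imsetP; exists (1, 0); last by rewrite /combine scale0r addr0.
      by rewrite in_setX k1; apply/imsetP; exists 0; rewrite ?mul0r ?fixd0.
    - move=> _ _ /imsetP[[x1 y1] /setXP[/= h1 /imsetP[z1 hz1 ->]] ->]
      /imsetP[[x2 y2] /setXP[/= h2 /imsetP[z2 hz2 ->]] ->].
      apply/imsetP; exists (x1 - x2, (z1 - z2) * y).
        by rewrite in_setX kB //; apply/imsetP; exists (z1 - z2); rewrite ?kB.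
      by rewrite /combine /=; apply/matrixP=> i j; rewrite !mxE; ring.
    - move=> _ _ /imsetP[[x1 y1] /setXP[/= h1 /imsetP[z1 hz1 ->]] ->]
      /imsetP[[x2 y2] /setXP[/= h2 /imsetP[z2 hz2 ->]] ->].
      apply/imsetP; exists (x1 * x2, (x1 * z2 + z1 * x2) * y).
        rewrite in_setX kM //; apply/imsetP; exists (x1 * z2 + z1 * x2) => //.
        have k0 := fixd0 F pp d.
        by rewrite -[z1 * x2]opprK kB ?kM // -sub0r kB ?kM.
      by rewrite (combineM _ _ _ _ vv0); congr (combine v (_, _)); ring.
  apply/imsetP; exists (x, y) => //; rewrite in_setX (fdeg_fix pp cardF) /=.
  by apply/imsetP; exists 1; rewrite ?mul1r.
have yv : y *: v \in gen a.
  have -> : y *: v = a - x%:M by rewrite /a /combine addrC addKr.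
  by rewrite gB ?gen_self ?sc_gen // (fdeg_fix pp cardF).
move=> _ /imsetP[[x1 y1] /setXP[/= h1 /imsetP[z1 hz1 ->]] ->].
(* Written as a difference because [subring_closed] provides subtraction rather than addition. *)
have -> : combine v (x1, z1 * y) = x1%:M - (- z1)%:M * (y *: v).
  by rewrite /combine /= scalar_mulr scaleNr opprK scalerA.
by rewrite gB ?gM ?sc_gen // -sub0r; case: (fixd_subring_closed pp cardF d) => _ kB _; rewrite kB ?fixd0.
Qed.

Lemma card_fiber_nil v : v \in nilpotents F -> #|fiber v| = nilpotent_count p n.
Proof.
move=> vN; have nv : v \notin scalars by move: vN; rewrite inE => /andP[].
rewrite -(card_fixd_fixd_line pp n0 cardF) -(card_imset _ (imset_inj (combine_inj nv))).
congr #|pred_of_set _|; apply/setP=> A; apply/imsetP/imsetP.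
  case=> b; rewrite inE => /andP[nb /(combineP nv)[x [y bE]]] ->.
  have y0 : y != 0 by move: nb; rewrite bE combine_scalar.
  rewrite bE gen_combine_nil //; eexists; last by [].
  by apply/imsetP; exists (x, y); rewrite ?inE.
case=> B /imsetP[[x y]]; rewrite inE /= => y0 -> ->.
exists (combine v (x, y)); last by rewrite gen_combine_nil.
by rewrite inE combine_scalar // y0 combine_commutant.
Qed.

(** For an eigenvalue [x], the matrix [b = a - x] is singular with the same commutant, and
    Cayley-Hamilton gives [b * b = t *: b] with t its trace. Then [b] is nilpotent if t = 0, and [b]
    divided by t is idempotent otherwise. *)
Lemma nonsplit_no_root a x : commutant a \in nonsplit_classes F ->
  a \notin scalars -> ~~ root (char_poly a) x.
Proof.
rewrite inE => /andP[nc _] na; rewrite -eigenvalue_root_char.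
apply: contra nc => /eigenvalueP[w wa w0]; pose b := a - x%:M.
have bE : b = combine a (- x, 1) by rewrite /combine /= scale1r raddfN addrC.
have nb : b \notin scalars by rewrite bE combine_scalar // oner_eq0.
have cb : commutant b = commutant a by apply: (commutant_eq na nb); rewrite bE combine_commutant.
have wb : w *m b = 0 by rewrite mulmxBr wa mul_mx_scalar subrr.
clearbody b.
have db : b 0 0 * b 1 1 = b 0 1 * b 1 0.
  have wbE j : w 0 0 * b 0 j + w 0 1 * b 1 j = 0.
    move/matrixP/(_ 0 j): wb; rewrite !mxE big_ord_recl big_ord1 => <-.
    by congr (_ * _ + w _ _ * b _ _); apply: val_inj.
  have [h0 h1] := (wbE 0, wbE 1).
  apply/eqP; rewrite -subr_eq0.
  (* Cramer: the determinant annihilates both entries of the nonzero kernel vector [w]. *)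
  have k0 : w 0 0 * (b 0 0 * b 1 1 - b 0 1 * b 1 0) = 0.
    transitivity ((w 0 0 * b 0 0 + w 0 1 * b 1 0) * b 1 1 - (w 0 0 * b 0 1 + w 0 1 * b 1 1) * b 1 0).
      by ring.
    by rewrite h0 h1 !mul0r subrr.
  have k1 : w 0 1 * (b 0 0 * b 1 1 - b 0 1 * b 1 0) = 0.
    transitivity ((w 0 0 * b 0 1 + w 0 1 * b 1 1) * b 0 0 - (w 0 0 * b 0 0 + w 0 1 * b 1 0) * b 0 1).
      by ring.
    by rewrite h0 h1 !mul0r subrr.
  apply: contraNT w0 => nz.
  move/eqP: k0; rewrite mulf_eq0 (negPf nz) orbF => /eqP w00.
  move/eqP: k1; rewrite mulf_eq0 (negPf nz) orbF => /eqP w01.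
  apply/eqP/matrixP=> i j; rewrite ord1 mxE.
  by case: j => [[|[|//]] lt]; [rewrite -w00|rewrite -w01]; congr (w _ _); apply: val_inj.
have bb : b * b = (b 0 0 + b 1 1) *: b.
  apply: eq_mx2; rewrite mulmx2E [RHS]mxE ?mulrDl -?db; try ring.
  by rewrite [b 1 0 * b 0 1]mulrC -db; ring.
rewrite -cb inE; have [t0|t0] := eqVneq (b 0 0 + b 1 1) 0.
  by apply/orP; right; apply: imset_f; rewrite inE nb inE bb t0 scale0r eqxx.
apply/orP; left; apply/imsetP; exists (combine b (0, (b 0 0 + b 1 1)^-1)).
  rewrite inE combine_scalar // invr_eq0 t0 inE (combine_sqr _ _ bb).
  by rewrite !addr0 add0r mul0r divff ?mul1r ?eqxx.
apply: esym; apply: (commutant_eq nb); last exact: combine_commutant.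
by rewrite combine_scalar // invr_eq0.
Qed.

Lemma size_filter_divisors m k : (0 < k)%N -> (m %| k)%N ->
  size [seq d <- divisors k | (d %| m)%N] = size (divisors m).
Proof.
move=> k0 mk; have m0 := dvdn_gt0 k0 mk.
apply: perm_size; apply: uniq_perm; rewrite ?filter_uniq ?divisors_uniq // => d.
rewrite mem_filter -!dvdn_divisors //.
by apply/andP/idP=> [[]//|dm]; rewrite dm (dvdn_trans dm).
Qed.

Lemma card_fiber_nonsplit a : a \notin scalars -> commutant a \in nonsplit_classes F ->
  #|fiber a| = nonsplit_count n.
Proof.
move=> na ac; pose h := char_poly a.
have hI : monic_irreducible_poly h.
  split; last exact: char_poly_monic.
  by apply: cubic_irreducible => [|x]; rewrite ?size_char_poly // nonsplit_no_root.
pose E : finFieldType := {poly %/ h with hI}.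
have cardE : #|E| = (p ^ (2 * n))%N.
  by rewrite card_qfpoly size_char_poly cardF -expnM mulnC.
pose phi (P : E) : M := horner_mx a (P : {poly F}).
have phiB : zmod_morphism phi by move=> P Q; rewrite /phi -rmorphB.
(* Products in [E] are reduced modulo [h], which vanishes at [a] by Cayley-Hamilton, so [phi] is
   multiplicative. *)
have modE R : horner_mx a R = horner_mx a (Pdiv.CommonRing.rmodp R (mk_monic h)).
  rewrite {1}(Pdiv.RingMonic.rdivp_eq (monic_mk_monic h) R) (mk_monicE hI).
  by rewrite rmorphD rmorphM /= Cayley_Hamilton mulr0 add0r.
have phiM : monoid_morphism phi.
  split; first by rewrite /phi -(rmorph1 (horner_mx a)).
  by move=> P Q; rewrite /phi -rmorphM [RHS]modE.
have phiI : injective phi.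
  pose g : {rmorphism E -> M} := HB.pack phi
    (GRing.isZmodMorphism.Build E M phi phiB) (GRing.isMonoidMorphism.Build E M phi phiM).
  exact: (fmorph_inj g).
have im : phi @: setT = commutant a.
  apply/eqP; rewrite eqEcard card_commutant // card_imset // cardsT cardE cardF.
  rewrite -expnM mulnC leqnn andbT; apply/subsetP=> _ /imsetP[P _ ->].
  by apply/commutantP; apply: comm_mx_horner.
have n20 : (0 < 2 * n)%N by rewrite muln_gt0.
have scE P : (phi P \in scalars) = (fdeg p P %| n)%N.
  rewrite -(fix_dvd pp cardE).
  (* Scalars satisfy x^q = x, and all q of them are values of [phi]. The fixed field has at most q
     elements, so the inclusion is an equality. *)
  suff /setP/(_ P) : [set Q | phi Q \in scalars] = fixd p E n by rewrite inE.
  apply/eqP; rewrite eqEcard; apply/andP; split.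
    apply/subsetP=> {}P; rewrite inE => /scalarsP[x xE]; apply/fixdP; apply: phiI.
    have phiX k : phi (P ^+ k) = phi P ^+ k.
      case: phiM => phi1 phiMM.
      by elim: k => [|k IH]; [rewrite !expr0 | rewrite [in LHS]exprS phiMM IH -exprS].
    rewrite phiX xE -cardF.
    have -> : (x%:M : M) ^+ #|F| = (x ^+ #|F|)%:M by rewrite -[LHS]rmorphXn.
    by rewrite expf_card.
  apply: leq_trans (card_fixd_le E pp n0) _; rewrite -cardF -card_scalars.
  rewrite -(card_imset [set Q | phi Q \in scalars] phiI); apply: subset_leq_card.
  apply/subsetP=> b bs; have : b \in commutant a by apply: (subsetP (scalars_commutant a)).
  by rewrite -im => /imsetP[Q _ bE]; rewrite bE; apply: imset_f; rewrite inE -bE.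
rewrite (card_fiber_morph phiI phiB phiM im) /nonsplit_count /num_divisors.
transitivity #|[set gen z | z : E & ~~ (fdeg p z %| n)%N]|.
  congr #|pred_of_set _|; apply/setP=> A; apply/imsetP/imsetP=> -[z].
    by rewrite inE scE => zn ->; exists z; rewrite ?inE.
  by rewrite inE => zn ->; exists z; rewrite ?inE ?scE.
rewrite (card_gen_fdeg pp n20 cardE (fun d => ~~ (d %| n)%N)).
rewrite -(size_filter_divisors n20 (dvdn_mull 2 (dvdnn n))) // size_filter.
rewrite -(count_predC (fun d => d %| n)%N (divisors (2 * n))) size_filter addKn.
by [].
Qed.

End Fibers.

(** * Graphs made of complete blocks *)

Section Blocks.
Variables (X C : finType) (W : {set X}) (kappa : X -> C).

(* Position of [x] in the enumeration of the blocks over [T]: the rank of its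
   block, then its rank inside that block. *)
Definition block_code (T : {set C}) (x : X) (i j : nat) : Prop :=
  [/\ x \in W, kappa x \in T, index (kappa x) (enum T) = i
    & index x (enum [set y in W | kappa y == kappa x]) = j].

Lemma enum_index_inj (U : finType) (A : {set U}) (x y : U) :
  x \in A -> index x (enum A) = index y (enum A) -> x = y.
Proof.
move=> xA e; have xe : x \in enum A by rewrite mem_enum.
by rewrite -(nth_index x xe) e nth_index // -index_mem -e index_mem.
Qed.

Lemma block_code_inj T x y i j : block_code T x i j -> block_code T y i j -> x = y.
Proof.
case=> xW xT xi xj [yW yT yi yj].
have kE : kappa x = kappa y by apply: (enum_index_inj xT); rewrite xi yi.
by apply: (@enum_index_inj _ _ _ _ _ (etrans xj (etrans (esym yj) _))); rewrite ?kE // inE xW kE eqxx.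
Qed.

Lemma block_code_class T x y i j i' j' :
  block_code T x i j -> block_code T y i' j' -> kappa x = kappa y <-> i = i'.
Proof.
case=> xW xT xi xj [yW yT yi yj]; split=> [e|e]; first by rewrite -xi -yi e.
by apply: (enum_index_inj xT); rewrite xi yi.
Qed.

Lemma block_code_disjoint (T T' : {set C}) x i j i' j' : [disjoint T & T'] ->
  block_code T x i j -> block_code T' x i' j' -> False.
Proof. by move=> d [_ xT _ _] [_ xT' _ _]; rewrite (disjointFr d xT) in xT'. Qed.

Lemma block_code_fun (T : {set C}) x (t s : nat) (ij ij' : 'I_t * 'I_s) :
  block_code T x ij.1 ij.2 -> block_code T x ij'.1 ij'.2 -> ij = ij'.
Proof.
case: ij ij' => [i j] [i' j'] [_ _ xi xj] [_ _ xi' xj'].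
by congr pair; apply: val_inj; [rewrite -[LHS]xi -[RHS]xi' | rewrite -[LHS]xj -[RHS]xj'].
Qed.

Variables (T : {set C}) (t s : nat).
Hypotheses (cardT : #|T| = t).
Hypothesis (card_block : forall c, c \in T -> #|[set y in W | kappa y == c]| = s).

Lemma block_code_total x : x \in W -> kappa x \in T ->
  exists ij : 'I_t * 'I_s, block_code T x ij.1 ij.2.
Proof.
move=> xW xT.
have li : (index (kappa x) (enum T) < t)%N.
  by rewrite -cardT fintype.cardE index_mem mem_enum.
have lj : (index x (enum [set y in W | kappa y == kappa x]) < s)%N.
  by rewrite -(card_block xT) fintype.cardE index_mem mem_enum inE xW eqxx.
by exists (Ordinal li, Ordinal lj).
Qed.

Lemma block_code_onto (ij : 'I_t * 'I_s) : exists x, block_code T x ij.1 ij.2.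
Proof.
case: ij => -[i li] [j lj] /=.
have [c cT ci] : exists2 c, c \in T & index c (enum T) = i.
  have li' : (i < size (enum T))%N by rewrite -fintype.cardE cardT.
  case E: (enum T) li' => [//|c0 r]; rewrite -E => li'.
  exists (nth c0 (enum T) i); first by rewrite -mem_enum mem_nth.
  by rewrite index_uniq ?enum_uniq.
have lj' : (j < size (enum [set y in W | kappa y == c]))%N by rewrite -fintype.cardE card_block.
case E: (enum _) lj' => [//|x0 r]; rewrite -E => lj'.
have := mem_nth x0 lj'; rewrite mem_enum inE => /andP[xW /eqP xc].
by exists (nth x0 (enum [set y in W | kappa y == c]) j); split; rewrite ?xc ?index_uniq ?enum_uniq.
Qed.

End Blocks.

(** [Z] holds the vertices adjacent to everything and [kappa] names the block of any other vertex.
    Numbers of blocks and their sizes determine such a graph up to isomorphism. *)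
Lemma graph_iso_join_blocks (G : graph) (X C : finType) (h : vertex G -> X)
    (V Z : {set X}) (kappa : X -> C) (T1 T2 T3 : {set C})
    (k t1 s1 t2 s2 t3 s3 : nat) :
  injective h -> (forall x, x \in V <-> exists u, h u = x) ->
  (forall u v, adj u v <-> [\/ h u \in Z, h v \in Z | kappa (h u) = kappa (h v)]) ->
  Z \subset V -> #|Z| = k ->
  (forall x, x \in V :\: Z -> [|| kappa x \in T1, kappa x \in T2 | kappa x \in T3]) ->
  [disjoint T1 & T2] -> [disjoint T1 & T3] -> [disjoint T2 & T3] ->
  #|T1| = t1 -> #|T2| = t2 -> #|T3| = t3 ->
  (forall c, c \in T1 -> #|[set x in V :\: Z | kappa x == c]| = s1) ->
  (forall c, c \in T2 -> #|[set x in V :\: Z | kappa x == c]| = s2) ->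
  (forall c, c \in T3 -> #|[set x in V :\: Z | kappa x == c]| = s3) ->
  graph_iso G
    (graph_join (looped_complete k)
       (graph_union
          (graph_union (graph_copies t1 (looped_complete s1))
                       (graph_copies t2 (looped_complete s2)))
          (graph_copies t3 (looped_complete s3)))).
Proof.
move=> hI hV hadj ZV cZ cover d12 d13 d23 c1 c2 c3 b1 b2 b3.
set H := graph_join _ _; pose W := V :\: Z.
(* A relation instead of a function: once it is total, onto, injective and single-valued, choice
   extracts both the map and its inverse. *)
pose code (x : X) (y : vertex H) : Prop :=
  match y with
  | inl i => x \in Z /\ index x (enum Z) = i
  | inr (inl (inl ij)) => block_code W kappa T1 x ij.1 ij.2
  | inr (inl (inr ij)) => block_code W kappa T2 x ij.1 ij.2
  | inr (inr ij) => block_code W kappa T3 x ij.1 ij.2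
  end.
have WZ x : x \in W -> x \in Z -> False by rewrite inE => /andP[/negP].
have tot x : x \in V -> exists y, code x y.
  move=> xV; have [xZ|nZ] := boolP (x \in Z).
    have li : (index x (enum Z) < k)%N by rewrite -cZ fintype.cardE index_mem mem_enum.
    by exists (inl (Ordinal li)).
  have xW : x \in W by rewrite inE nZ.
  case/or3P: (cover x xW) => xT.
  - by have [ij] := block_code_total c1 b1 xW xT; exists (inr (inl (inl ij))).
  - by have [ij] := block_code_total c2 b2 xW xT; exists (inr (inl (inr ij))).
  - by have [ij] := block_code_total c3 b3 xW xT; exists (inr (inr ij)).
have onto y : exists2 x, x \in V & code x y.
  have inV x : x \in W -> x \in V by rewrite inE => /andP[].
  case: y => [[i li]|[[ij|ij]|ij]].
  - have li' : (i < size (enum Z))%N by rewrite -fintype.cardE cZ.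
    case E: (enum Z) li' => [//|x0 r]; rewrite -E => li'.
    have xZ : nth x0 (enum Z) i \in Z by rewrite -mem_enum mem_nth.
    exists (nth x0 (enum Z) i); first exact: (subsetP ZV).
    by split=> //=; rewrite index_uniq ?enum_uniq.
  - by have [x xc] := block_code_onto c1 b1 ij; exists x => //; apply: inV; case: xc.
  - by have [x xc] := block_code_onto c2 b2 ij; exists x => //; apply: inV; case: xc.
  - by have [x xc] := block_code_onto c3 b3 ij; exists x => //; apply: inV; case: xc.
have inj x x' y : code x y -> code x' y -> x = x'.
  case: y => [i|[[ij|ij]|ij]] /=; try exact: block_code_inj.
  by case=> xZ xi [x'Z x'i]; apply: (enum_index_inj xZ); rewrite xi x'i.
have zb T x i j : x \in Z -> block_code W kappa T x i j -> False.
  by move=> xZ [xW _ _ _]; apply: WZ xW xZ.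
have func x y y' : code x y -> code x y' -> y = y'.
  have zz (i i' : 'I_k) : code x (inl i) -> code x (inl i') -> i = i'.
    by case=> _ xi [_ xi']; apply: val_inj; rewrite -[LHS]xi -[RHS]xi'.
  case: y => [i|[[ij|ij]|ij]]; case: y' => [i'|[[ij'|ij']|ij']] c c'.
  - by rewrite (zz _ _ c c').
  - by case: (zb _ _ _ _ c.1 c').
  - by case: (zb _ _ _ _ c.1 c').
  - by case: (zb _ _ _ _ c.1 c').
  - by case: (zb _ _ _ _ c'.1 c).
  - by rewrite (block_code_fun c c').
  - by case: (block_code_disjoint d12 c c').
  - by case: (block_code_disjoint d13 c c').
  - by case: (zb _ _ _ _ c'.1 c).
  - by case: (block_code_disjoint d12 c' c).
  - by rewrite (block_code_fun c c').
  - by case: (block_code_disjoint d23 c c').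
  - by case: (zb _ _ _ _ c'.1 c).
  - by case: (block_code_disjoint d13 c' c).
  - by case: (block_code_disjoint d23 c' c).
  - by rewrite (block_code_fun c c').
have adjE x x' y y' : code x y -> code x' y' ->
    adj y y' <-> [\/ x \in Z, x' \in Z | kappa x = kappa x'].
  have [nz|nz] := boolP ((x \in Z) || (x' \in Z)).
    move=> c c'; split=> [_|_]; first by case/orP: nz; [constructor 1|constructor 2].
    move: c c'; case: y => [i|[[ij|ij]|ij]]; case: y' => [i'|[[ij'|ij']|ij']] c c' //;
      by case/orP: nz => xZ; [case: (zb _ _ _ _ xZ c) | case: (zb _ _ _ _ xZ c')].
  move: nz; rewrite negb_or => /andP[/negP nx /negP nx'] c c'.
  suff e : adj y y' <-> kappa x = kappa x' by rewrite e; split=> [?|[]//]; constructor 3.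
  have sep (S S' : {set C}) i j i' j' : [disjoint S & S'] ->
      block_code W kappa S x i j -> block_code W kappa S' x' i' j' -> kappa x <> kappa x'.
    by move=> d [_ xS _ _] [_ xS' _ _] e; rewrite -e (disjointFr d xS) in xS'.
  have sep' (S S' : {set C}) i j i' j' : [disjoint S' & S] ->
      block_code W kappa S x i j -> block_code W kappa S' x' i' j' -> kappa x <> kappa x'.
    by rewrite disjoint_sym; apply: sep.
  have same (S : {set C}) t s (ij ij' : 'I_t * 'I_s) : block_code W kappa S x ij.1 ij.2 ->
      block_code W kappa S x' ij'.1 ij'.2 -> ij.1 = ij'.1 /\ True <-> kappa x = kappa x'.
    move=> b b'; rewrite (block_code_class b b'); split=> [[->]//|e]; split=> //.
    exact: val_inj.
  move: c c'; case: y => [i|[[ij|ij]|ij]]; case: y' => [i'|[[ij'|ij']|ij']] c c'.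
  - by case: nx; case: c.
  - by case: nx; case: c.
  - by case: nx; case: c.
  - by case: nx; case: c.
  - by case: nx'; case: c'.
  - exact: same c c'.
  - by split=> // /(sep _ _ _ _ _ _ d12 c c').
  - by split=> // /(sep _ _ _ _ _ _ d13 c c').
  - by case: nx'; case: c'.
  - by split=> // /(sep' _ _ _ _ _ _ d12 c c').
  - exact: same c c'.
  - by split=> // /(sep _ _ _ _ _ _ d23 c c').
  - by case: nx'; case: c'.
  - by split=> // /(sep' _ _ _ _ _ _ d13 c c').
  - by split=> // /(sep' _ _ _ _ _ _ d23 c c').
  - exact: same c c'.
have totG u : exists y, code (h u) y by apply: tot; apply/hV; exists u.
have [f fE] := boolp.choice totG.
have ontoG y : exists u, code (h u) y.
  by have [x /hV[u <-] xy] := onto y; exists u.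
have [g gE] := boolp.choice ontoG.
exists f; split.
  exists g => [u|y]; first exact/hI/(inj _ _ (f u)).
  exact: func (fE _) (gE _).
by move=> u v; rewrite hadj; apply: iff_sym; apply: adjE.
Qed.

(** * Vertices of the compressed commuting graph as finite sets *)

Section Vertices.
Variable F : finFieldType.
Local Notation M := 'M[F]_2.
Implicit Types a b : M.

(** The block label, computed from the subring itself and therefore independent of the generator. *)
Definition set_commutant (A : {set M}) : {set M} :=
  [set x | [forall y in A, y * x == x * y]].

Lemma set_commutant_gen a : set_commutant (gen a) = commutant a.
Proof.
apply/setP=> x; rewrite !inE; apply/forall_inP/eqP=> [h|h y /genP[q ->]].
  exact/eqP/h/gen_self.
by apply/eqP/esym; apply: comm_horner_int; rewrite /GRing.comm -h.
Qed.

(** Scalars form a subring, so a subring with one scalar generator has only scalar generators. *)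
Lemma gen_scalars a : (gen a \in [set gen b | b in scalars F]) = (a \in scalars F).
Proof.
apply/imsetP/idP=> [[_ /scalarsP[x ->] e]|aS]; last by exists a.
have: a \in gen x%:M by rewrite -e gen_self.
apply: gen_sub; last by apply/scalarsP; exists x.
split=> [|_ _ /scalarsP[y ->] /scalarsP[z ->]|_ _ /scalarsP[y ->] /scalarsP[z ->]].
- by apply/scalarsP; exists 1.
- by apply/scalarsP; exists (y - z); rewrite raddfB.
- by apply/scalarsP; exists (y * z); rewrite scalar_mxM.
Qed.

Definition vertex_set (u : subring_vertex M) : {set M} := [set x | `[< sval u x >]].

Lemma vertex_setE u a : sval u = unital_subring_gen a -> vertex_set u = gen a.
Proof. by rewrite /vertex_set /gen => ->. Qed.

Lemma vertex_set_inj : injective vertex_set.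
Proof.
move=> [A hA] [B hB] /setP e; apply: eq_exist; apply/predeqP=> x.
have := e x; rewrite !inE /=; exact: asbool_eq_equiv.
Qed.

Lemma fiberE a : a \notin scalars F ->
  [set A in [set gen b | b : M] :\: [set gen b | b in scalars F]
     | set_commutant A == commutant a] = fiber a.
Proof.
move=> na; apply/setP=> A; rewrite inE; apply/andP/imsetP=> [[]|[b]].
  case/setDP=> /imsetP[b _ ->]; rewrite gen_scalars set_commutant_gen => nb.
  by rewrite commutant_eqE // => ba; exists b => //; rewrite inE nb.
case/setDP=> ba nb ->; rewrite set_commutant_gen commutant_eqE //; split=> //.
by rewrite inE gen_scalars nb; apply: imset_f.
Qed.

End Vertices.

Theorem theorem21 (n p : nat) (F : finFieldType)
  (hn : (1 <= n)%N) (hp : prime p) (hF : #|F| = (p ^ n)%N) :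
  graph_iso
    (compressed_commuting_graph 'M[F]_2)
    (graph_join
       (looped_complete (num_divisors n))
       (graph_union
          (graph_union
             (graph_copies ((p ^ (2 * n) + p ^ n) %/ 2)%N
                (looped_complete (split_count p n)))
             (graph_copies (p ^ n + 1)%N
                (looped_complete (nilpotent_count p n))))
          (graph_copies ((p ^ (2 * n) - p ^ n) %/ 2)%N
             (looped_complete (nonsplit_count n))))).
Proof.
have nidem e : e \in idempotents F -> e \notin scalars F by rewrite inE => /andP[].
have nnil v : v \in nilpotents F -> v \notin scalars F by rewrite inE => /andP[].
have nnons c : c \in nonsplit_classes F ->
    exists2 a, a \notin scalars F & c = commutant a.
  by rewrite inE => /andP[_ /imsetP[a]]; rewrite inE => na ->; exists a.
have qq : (p ^ (2 * n) = #|F| ^ 2)%N by rewrite hF -expnM mulnC.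
rewrite qq -hF.
apply: (@graph_iso_join_blocks (compressed_commuting_graph 'M[F]_2) _ _ (@vertex_set F) [set gen a | a : 'M[F]_2]
  [set gen a | a in scalars F] (@set_commutant F)
  (split_classes F) (nil_classes F) (nonsplit_classes F)).
- exact: vertex_set_inj.
- move=> A; split=> [/imsetP[a _ ->]|[u <-]].
    by exists (exist _ (unital_subring_gen a) (ex_intro _ a erefl)); apply: vertex_setE.
  by case: (svalP u) => a ua; rewrite (vertex_setE ua) imset_f.
- move=> u v; case: (svalP u) => a ua; case: (svalP v) => b vb.
  rewrite (vertex_setE ua) (vertex_setE vb) !gen_scalars !set_commutant_gen.
  apply: iff_trans (commuting_adjE ua vb) _; split=> [ab|].
    have [aS|na] := boolP (a \in scalars F); first by constructor 1.
    have [bS|nb] := boolP (b \in scalars F); first by constructor 2.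
    by constructor 3; symmetry; apply: commutant_eq => //; apply/commutantP.
  case=> [aS|bS|e]; apply/commutantP; first by rewrite commutant_scalar ?inE.
    have : a \in commutant b by rewrite commutant_scalar ?inE.
    by move/commutantP=> h; apply/commutantP.
  by rewrite e; apply/commutantP.
- by apply/subsetP=> _ /imsetP[a _ ->]; apply: imset_f.
- exact: card_gen_scalars hn hp hF.
- move=> _ /setDP[/imsetP[a _ ->]]; rewrite gen_scalars set_commutant_gen => na.
  rewrite orbA -in_setU; case: (boolP (_ \in _ :|: _)) => //= nc.
  by rewrite inE nc imset_f ?inE.
- exact: split_nil_disjoint.
- by rewrite disjoint_sym disjoints_subset; apply/subsetP=> c; rewrite !inE negb_or -andbA => /and3P[].
- by rewrite disjoint_sym disjoints_subset; apply/subsetP=> c; rewrite !inE negb_or -andbA => /and3P[].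
- exact: card_split_classes.
- exact: card_nil_classes.
- exact: card_nonsplit_classes.
- by move=> _ /imsetP[e eI ->]; rewrite fiberE ?nidem // (card_fiber_split hn hp hF).
- by move=> _ /imsetP[v vN ->]; rewrite fiberE ?nnil // (card_fiber_nil hn hp hF).
- by move=> c cN; have [a na ca] := nnons c cN; rewrite ca fiberE // (card_fiber_nonsplit hn hp hF) // -ca.
Qed.
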